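(* For every $T>0$ there exists a $T$-periodic solution $u_*\in\mathcal{K}_4$ of the classical Newtonian $4$-body problem (with four unit masses).
   Context: Fix $T>0$. The classical Newtonian $4$-body problem with unit masses (and unit gravitational constant) is $\ddot u_i=\sum_{j\ne i}\frac{u_j-u_i}{|u_j-u_i|^3}$, $i=1,\dots,4$, $u_i:\mathbb{R}\to\mathbb{R}^3$; a solution is in particular collision free. Let $O\xi_1\xi_2\xi_3$ be an orthogonal frame in $\mathbb{R}^3$, let $S_j$ be the reflection with respect to the plane $\xi_j=0$ and $R_j$ the rotation of angle $\pi$ around the axis $\xi_j$, $j=1,2,3$. Let $\mathcal{X}=\{x=(x_1,\dots,x_4)\in\mathbb{R}^{12}:\sum_h x_h=0\}$ and let $H^1_T(\mathbb{R},\mathcal{X})$ be the space of $T$-periodic $L^2$ maps $u:\mathbb{R}\to\mathcal{X}$ with $L^2$ first derivative. Let $\Lambda_G\subset H^1_T(\mathbb{R},\mathcal{X})$ be the set of $u=(u_1,u_2,u_3,u_4)$ such that, for all $t\in\mathbb{R}$, $$u_1(t)=S_3u_1(-t),\qquad u_1(\tfrac T4+t)=S_2u_1(\tfrac T4-t),$$ $$u_2(t)=R_3u_1(t),\quad u_3(t)=R_1u_1(t),\quad u_4(t)=R_2u_1(t).$$ Write $u_1=(u_{11},u_{12},u_{13})$ and define $\mathcal{K}_4=\{u\in\Lambda_G:\ u_{11}(0)\,u_{11}(T/4)<0\}$. *)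

(* Defs.v *)
From HB Require Import structures.
From mathcomp Require Import all_boot all_order all_algebra.
From mathcomp Require Import all_classical all_reals all_analysis.

Set Implicit Arguments.
Unset Strict Implicit.
Unset Printing Implicit Defensive.

Import Order.TTheory GRing.Theory Num.Theory.
Import numFieldNormedType.Exports.

Local Open Scope classical_set_scope.
Local Open Scope ring_scope.

(* Indices start at 0: body i of type 'I_4 is u_(i+1), and axis j of type 'I_3
   is xi_(j+1). Row vectors of 'rV[R]_3 are coordinates in the orthogonal frame
   O xi_1 xi_2 xi_3. *)

(* Not `|x|, which is the sup norm on 'rV[R]_3. *)
Definition eucl_norm (R : realType) (x : 'rV[R]_3) : R :=
  Num.sqrt (\sum_(k < 3) x 0 k ^+ 2).

Definition refl (R : realType) (j : 'I_3) (x : 'rV[R]_3) : 'rV[R]_3 :=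
  \row_(k < 3) (if k == j then - x 0 k else x 0 k).

Definition half_turn (R : realType) (j : 'I_3) (x : 'rV[R]_3) : 'rV[R]_3 :=
  \row_(k < 3) (if k == j then x 0 k else - x 0 k).

(* Collision-freeness is required explicitly, since 0^-1 = 0 makes the force
   total. *)
Definition newton_solution (R : realType) (u : 'I_4 -> R -> 'rV[R]_3) : Prop :=
  forall (i : 'I_4) (t : R),
    [/\ forall j : 'I_4, j != i -> u j t != u i t,
        derivable (u i) t 1,
        derivable (derive1 (u i)) t 1
      & derive1n 2 (u i) t =
          \sum_(j < 4 | j != i)
             (eucl_norm (u j t - u i t) ^+ 3)^-1 *: (u j t - u i t)].

Definition L2_period (R : realType) (T : R) (f : R -> R) : Prop :=
  f \_ `[0, T] \in Lfun (@lebesgue_measure R) 2%:E.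

Definition smooth (R : realType) (phi : R -> R) : Prop :=
  forall (n : nat) (t : R), derivable (derive1n n phi) t 1.

(* Weak derivative of a T-periodic function, tested against smooth T-periodic
   functions. *)
Definition weak_deriv_period (R : realType) (T : R) (f g : R -> R) : Prop :=
  forall phi : R -> R, smooth phi -> periodic phi T ->
    \int[@lebesgue_measure R]_(t in `[0, T]) (f t * derive1 phi t) =
    - \int[@lebesgue_measure R]_(t in `[0, T]) (g t * phi t).

(* Classes of H^1_T are identified with their continuous representatives, so
   that pointwise values of u make sense. *)
Definition H1_period (R : realType) (T : R) (f : R -> R) : Prop :=
  [/\ continuous f, periodic f T, L2_period T f
    & exists2 g : R -> R, L2_period T g & weak_deriv_period T f g].

Definition H1_centered (R : realType) (T : R) (u : 'I_4 -> R -> 'rV[R]_3) :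
    Prop :=
  (forall t : R, \sum_(h < 4) u h t = 0) /\
  (forall (i : 'I_4) (k : 'I_3), H1_period T (fun t => u i t 0 k)).

Definition Lambda_G (R : realType) (T : R) (u : 'I_4 -> R -> 'rV[R]_3) : Prop :=
  H1_centered T u /\
  forall t : R,
    [/\ u 0 t = refl 2 (u 0 (- t)),
        u 0 (T / 4 + t) = refl 1 (u 0 (T / 4 - t)),
        u 1 t = half_turn 2 (u 0 t),
        u 2 t = half_turn 0 (u 0 t)
      & u 3 t = half_turn 1 (u 0 t)].

Definition K4 (R : realType) (T : R) (u : 'I_4 -> R -> 'rV[R]_3) : Prop :=
  Lambda_G T u /\ u 0 0 0 0 * u 0 (T / 4) 0 0 < 0.

(* Main.v *)
From HB Require Import structures.
From mathcomp Require Import all_boot all_order all_algebra.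
From mathcomp Require Import all_classical all_reals all_analysis.
From mathcomp Require Import measurable_realfun.
From mathcomp Require Import ring lra zify.
Require Import Defs.

(** The symmetry reduces the four bodies to one point (x, y, z), whose mutual
distances are twice the norms of its projections on the coordinate planes, so
that the Lagrangian is the sum over these planes of the planar Kepler
Lagrangians |p'|^2 + 1/|p|.  Normalise T = 4, so that a quarter of the period
is [0, 1], and ask moreover that x(1 - t) = - x(t) and z(t) = y(1 - t).  These
conditions are linear and force x(0) x(1) <= 0, so no topological constraint
remains: a critical point without collision automatically has x(0) x(1) < 0,
because z(0) = y(1) = 0.  With this extra symmetry the action on [0, 1] is
2 P + Q, where P is the Kepler action of (x, y) and Q that of (y, z).

Collisions are excluded by comparing levels.  Always P, Q >= 2.37, since y
vanishes at 1 and x at 1/2 ([xy_action_quarter], [yz_action_quarter]).  A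
collision forces P >= 7.15 / 2 or Q >= 5.65 ([collision_bound], a calibration of
the radial Kepler problem), hence an action above 9.5; but the loop
x = 0.3 (1 - 2 t), y = (2/3) (1 - t^2) has action below 9.48 ([test_action]).

The minimiser is built on a grid with mesh h and with the distance r replaced
by sqrt (r^2 + h^2).  The discrete problem is finite dimensional and smooth, so
it has a minimiser ([exists_minimiser]), which solves a second order recurrence
([euler_lagrange_x], [euler_lagrange_y]); all the inequalities above hold for it,
so its distances stay above a constant independent of h ([no_near_collision]).
Therefore positions, velocities and accelerations are bounded and Lipschitz
uniformly in h.  Along an ultrafilter finer than the filter of large integers
all of them converge at every time, and the inequality
|a(s) - a(t) - (s - t) b(t)| <= C (s - t)^2, which holds on the grid for
(position, velocity) and for (velocity, acceleration), passes to the limit and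
says that b is the derivative of a ([limit_of_derive]).  This gives the reduced
solution ([exists_reduced_solution]); a rescaling with l^3 = T^2 / 16 gives period
T.  *)

Set Implicit Arguments.
Unset Strict Implicit.
Unset Printing Implicit Defensive.

Import Order.TTheory GRing.Theory Num.Theory.
Import numFieldNormedType.Exports.

Local Open Scope classical_set_scope.
Local Open Scope ring_scope.

(** * The softened distance and the cost of approaching a collision *)

Section Collision.
Context (R : realType).
Implicit Types (a b d h u v w : R) (n i : nat).

Lemma telescope_le (f g : nat -> R) n :
  (forall i, (i < n)%N -> g i.+1 - g i <= f i) ->
  g n - g 0%N <= \sum_(i < n) f i.
Proof.
elim: n => [|n IH] H; first by rewrite big_ord0 subrr.
rewrite big_ord_recr /=.
have := H n (leqnn _).
have : g n - g 0%N <= \sum_(i < n) f i by apply: IH => i /ltnW; exact: H.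
lra.
Qed.

Lemma telescope_ge (f g : nat -> R) n :
  (forall i, (i < n)%N -> f i <= g i.+1 - g i) ->
  \sum_(i < n) f i <= g n - g 0%N.
Proof.
move=> H; have := @telescope_le (fun i => - f i) (fun i => - g i) n.
rewrite sumrN => {}H1; suff : - g n - - g 0%N <= - \sum_(i < n) f i by lra.
by apply: H1 => i im; have := H i im; lra.
Qed.

(** For d > 0 its inverse is smooth and bounded, so that the minimisation below
needs no constraint on collisions. *)
Definition soft_norm d a b : R := Num.sqrt (a ^+ 2 + b ^+ 2 + d ^+ 2).

Lemma sqr_soft_norm d a b : soft_norm d a b ^+ 2 = a ^+ 2 + b ^+ 2 + d ^+ 2.
Proof. by rewrite sqr_sqrtr // !addr_ge0 ?sqr_ge0. Qed.

Lemma soft_norm_gt0 d a b : 0 < d -> 0 < soft_norm d a b.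
Proof. by move=> d0; rewrite sqrtr_gt0 ltr_wpDl ?addr_ge0 ?sqr_ge0 ?exprn_gt0. Qed.

Lemma soft_norm_lip d a b a' b' :
  (soft_norm d a b - soft_norm d a' b') ^+ 2 <= (a - a') ^+ 2 + (b - b') ^+ 2.
Proof.
have r0 : 0 <= soft_norm d a b by exact: sqrtr_ge0.
have r'0 : 0 <= soft_norm d a' b' by exact: sqrtr_ge0.
have E := sqr_soft_norm d a b; have E' := sqr_soft_norm d a' b'.
set r := soft_norm d a b in r0 E *; set r' := soft_norm d a' b' in r'0 E' *.
have : a * a' + b * b' + d ^+ 2 <= r * r'.
  have [neg|pos] := ltP (a * a' + b * b' + d ^+ 2) 0.
    by apply: le_trans (ltW neg) _; exact: mulr_ge0.
  rewrite -(@ler_pXn2r _ 2) ?nnegrE ?mulr_ge0 // exprMn E E'.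
  have := sqr_ge0 (a * b' - b * a'); have := sqr_ge0 (d * (a - a')).
  have := sqr_ge0 (d * (b - b')); lra.
lra.
Qed.

(** One time step of the calibration, for r running from u^2 to v^2.  In the
variable u = sqrt r the radial Lagrangian r'^2 + 1/r dominates
4 al u' + (1 - al^2) / u^2 for every slope al, by completing the square
(r' - al / u)^2 >= 0; the trapezoid rule for 1/r keeps the inequality exact on
the grid, by convexity of u |-> 1 / u^2. *)
Lemma collision_step h (al u v : R) : 0 < h -> 0 < u -> 0 < v ->
  4 * al * (v - u) + h * ((1 - al ^+ 2) / ((u + v) / 2) ^+ 2) <=
  (v ^+ 2 - u ^+ 2) ^+ 2 / h + h / 2 * ((u ^+ 2)^-1 + (v ^+ 2)^-1).
Proof.
move=> h0 u0 v0.
set w := (u + v) / 2; have w0 : 0 < w by rewrite divr_gt0 ?addr_gt0.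
have trap : h * (w ^+ 2)^-1 <= h / 2 * ((u ^+ 2)^-1 + (v ^+ 2)^-1).
  rewrite -mulrA ler_pM2l //.
  have -> : 2^-1 * ((u ^+ 2)^-1 + (v ^+ 2)^-1) =
    (u ^+ 2 + v ^+ 2) / (2 * u ^+ 2 * v ^+ 2).
    by field; rewrite !gt_eqF.
  rewrite ler_pdivlMr ?mulr_gt0 ?exprn_gt0 // mulrC.
  rewrite ler_pdivrMr ?exprn_gt0 // /w.
  have p : 0 < u * v by exact: mulr_gt0.
  rewrite -subr_ge0.
  have -> : (u ^+ 2 + v ^+ 2) * ((u + v) / 2) ^+ 2 - 2 * u ^+ 2 * v ^+ 2 =
    (u - v) ^+ 2 * ((u - v) ^+ 2 + 6 * (u * v)) / 4 by field.
  apply: divr_ge0 => //; apply: mulr_ge0; first exact: sqr_ge0.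
  by have := sqr_ge0 (u - v); lra.
have kin : 4 * al * (v - u) - h * (al ^+ 2 / w ^+ 2) <=
    (v ^+ 2 - u ^+ 2) ^+ 2 / h.
  have -> : v ^+ 2 - u ^+ 2 = 2 * w * (v - u) by rewrite /w; field.
  rewrite ler_pdivlMr //.
  have -> : (4 * al * (v - u) - h * (al ^+ 2 / w ^+ 2)) * h =
    4 * (w * (v - u)) * (h * al / w) - (h * al / w) ^+ 2.
    by field; rewrite gt_eqF.
  have := sqr_ge0 (2 * w * (v - u) - h * al / w); lra.
have -> : h * ((1 - al ^+ 2) / w ^+ 2) = h * (w ^+ 2)^-1 - h * (al ^+ 2 / w ^+ 2).
  by rewrite [(1 - _) / _]mulrBl mul1r mulrBr.
lra.
Qed.

(** The arithmetic-geometric inequality bounds 4 K w + be / w^2 below by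
3 (4 K^2 be)^(1/3); the factor be (5 - 2 be) / 3 is a polynomial lower bound of
be^(1/3) on [0, 1], tangent at 1, and s^2 is a lower bound of (4 K^2)^(1/3). *)
Lemma collision_amgm (s K be w : R) : 0 <= s -> s ^+ 3 <= 2 * K ->
  0 <= be <= 1 -> 0 < w ->
  s ^+ 2 * (be * (5 - 2 * be)) <= 4 * K * w + be / w ^+ 2.
Proof.
move=> s0 sK /andP[b0 b1] w0.
set p := be * (5 - 2 * be) / 3.
have p0 : 0 <= p by rewrite /p divr_ge0 ?mulr_ge0 //; lra.
have pb : p ^+ 3 <= be.
  have -> : p ^+ 3 = be * (be ^+ 2 * (5 - 2 * be) ^+ 3 / 27) by rewrite /p; field.
  rewrite ler_piMr // ler_pdivrMr // mul1r.
  have -> : be ^+ 2 * (5 - 2 * be) ^+ 3 =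
    27 - (1 - be) ^+ 2 * (27 + 54 * be  - 44 * be ^+ 2 + 8 * be ^+ 3) by ring.
  rewrite gerBl mulr_ge0 ?sqr_ge0 //.
  have : 0 <= be ^+ 3 by rewrite exprn_ge0.
  have : be ^+ 2 <= be by rewrite expr2 ler_piMr.
  lra.
have -> : s ^+ 2 * (be * (5 - 2 * be)) = 3 * s ^+ 2 * p by rewrite /p; field.
apply: (@le_trans _ _ (2 * s ^+ 3 * w + p ^+ 3 / w ^+ 2)); last first.
  apply: lerD; first by rewrite ler_pM2r //; lra.
  by rewrite ler_pM2r // invr_gt0 exprn_gt0.
rewrite -subr_ge0.
have -> : 2 * s ^+ 3 * w + p ^+ 3 / w ^+ 2 - 3 * s ^+ 2 * p =
  (p - s * w) ^+ 2 * (p + 2 * s * w) / w ^+ 2.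
  by field; rewrite gt_eqF.
apply: divr_ge0; last exact: sqr_ge0.
apply: mulr_ge0; first exact: sqr_ge0.
by rewrite addr_ge0 // ?mulr_ge0 // ltW.
Qed.

(** The calibration of a path that leaves the collision at its first point.  The
slope al decreases linearly from 1, where it cancels the singularity of the
potential, to 0 at the free end; its decrease, at rate at least K, turns the
total derivative of 4 al u into the term 4 K u, to which [collision_amgm]
applies.  The number 34/15 is the integral of (1 - al^2) (3 + 2 al^2) over
[0, 1]. *)
Lemma collision_bound n (h K s : R) (r : nat -> R) :
  0 < h -> 0 <= s -> s ^+ 3 <= 2 * K -> K * (n%:R * h) <= 1 ->
  (forall i, (i <= n)%N -> 0 < r i) ->
  34 / 15 * s ^+ 2 * (n%:R * h) - 4 * Num.sqrt (r 0%N) <=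
  \sum_(i < n) ((r i.+1 - r i) ^+ 2 / h + h / 2 * ((r i)^-1 + (r i.+1)^-1)).
Proof.
move=> h0 s0 sK Kn rpos.
have [->|n0] := posnP n.
  by rewrite big_ord0 mul0r mulr0 sub0r oppr_le0 mulr_ge0 ?sqrtr_ge0.
have N0 : 0 < n%:R :> R by rewrite ltr0n.
pose al (i : nat) : R := 1 - i%:R / n%:R.
pose u i := Num.sqrt (r i).
(* The second summand is a primitive of s^2 (1 - al^2) (3 + 2 al^2). *)
pose g i := 4 * al i * u i +
  s ^+ 2 * (n%:R * h) * (3 * (i%:R / n%:R) + al i ^+ 3 / 3 + 2 * al i ^+ 5 / 5).
have := @telescope_le (fun i =>
  (r i.+1 - r i) ^+ 2 / h + h / 2 * ((r i)^-1 + (r i.+1)^-1)) g n.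
have -> : g n = s ^+ 2 * (n%:R * h) * 3.
  by rewrite /g /al divff ?gt_eqF // subrr; ring.
have -> : g 0%N = 4 * u 0%N + s ^+ 2 * (n%:R * h) * (11 / 15).
  by rewrite /g /al mul0r subr0; field.
move=> H; apply: le_trans (H _); first by rewrite -/(u 0%N); lra.
move=> i ltin; set ui := u i; set vi := u i.+1.
have ui0 : 0 < ui by rewrite sqrtr_gt0 rpos // ltnW.
have vi0 : 0 < vi by rewrite sqrtr_gt0 rpos.
have -> : r i = ui ^+ 2 by rewrite sqr_sqrtr // ltW // rpos // ltnW.
have -> : r i.+1 = vi ^+ 2 by rewrite sqr_sqrtr // ltW // rpos.
(* With the mean slope, the discrete product rule for al * u is exact. *)
set am := (al i + al i.+1) / 2.
apply: le_trans (collision_step am h0 ui0 vi0).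
have e : 0 < (n%:R : R)^-1 by rewrite invr_gt0.
have alS : al i.+1 = al i - n%:R^-1 by rewrite /al -natr1 mulrDl; ring.
have ai1 : al i <= 1 by rewrite /al gerBl divr_ge0.
have ai0 : 0 <= al i.+1.
  by rewrite /al subr_ge0 ler_pdivrMr // mul1r ler_nat.
have am01 : 0 <= 1 - am ^+ 2 <= 1.
  have am0 : 0 <= am <= 1 by rewrite /am; apply/andP; split; lra.
  have := sqr_ge0 am; have : am ^+ 2 <= 1 by rewrite expr_le1 //; lra.
  by lra.
have w0 : 0 < (ui + vi) / 2 by rewrite divr_gt0 ?addr_gt0.
have K1 : K <= (n%:R * h)^-1.
  by rewrite -[leRHS]mul1r ler_pdivlMr ?mulr_gt0.
have := collision_amgm s0 (le_trans sK _) am01 w0.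
move=> /(_ (n%:R * h)^-1); rewrite ler_pM2l // => /(_ K1).
rewrite -(ler_pM2l h0) => AM.
have kh : h * (4 * (n%:R * h)^-1 * ((ui + vi) / 2)) = 4 * n%:R^-1 * ((ui + vi) / 2).
  by field; rewrite !gt_eqF.
rewrite [h * (_ + _)]mulrDr {}kh in AM.
rewrite /g -/ui -/vi.
have iS : i.+1%:R / n%:R = i%:R / n%:R + n%:R^-1 :> R by rewrite -natr1 mulrDl mul1r.
rewrite iS.
have poly : s ^+ 2 * (n%:R * h) * (3 * (i%:R / n%:R + n%:R^-1) + al i.+1 ^+ 3 / 3
     + 2 * al i.+1 ^+ 5 / 5) -
   s ^+ 2 * (n%:R * h) * (3 * (i%:R / n%:R) + al i ^+ 3 / 3 + 2 * al i ^+ 5 / 5)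
   <= h * (s ^+ 2 * ((1 - am ^+ 2) * (5 - 2 * (1 - am ^+ 2)))).
  have -> : h * (s ^+ 2 * ((1 - am ^+ 2) * (5 - 2 * (1 - am ^+ 2)))) =
     s ^+ 2 * (n%:R * h) * (n%:R^-1 * ((1 - am ^+ 2) * (3 + 2 * am ^+ 2))).
    by field; rewrite gt_eqF.
  rewrite -mulrBr; apply: ler_wpM2l.
    by apply: mulr_ge0; [exact: sqr_ge0|apply: mulr_ge0; rewrite ltW].
  have -> : al i = am + n%:R^-1 / 2 by rewrite /am alS; field; rewrite ?gt_eqF.
  have -> : al i.+1 = am - n%:R^-1 / 2 by rewrite /am alS; field; rewrite ?gt_eqF.
  set e' := n%:R^-1; rewrite -subr_ge0.
  have -> : e' * ((1 - am ^+ 2) * (3 + 2 * am ^+ 2)) -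
   (3 * (i%:R / n%:R + e') + (am - e' / 2) ^+ 3 / 3 + 2 * (am - e' / 2) ^+ 5 / 5 -
   (3 * (i%:R / n%:R) + (am + e' / 2) ^+ 3 / 3 + 2 * (am + e' / 2) ^+ 5 / 5)) =
   e' ^+ 3 * (1 / 12 + am ^+ 2 + e' ^+ 2 / 40).
     by field; rewrite ?gt_eqF.
  apply: mulr_ge0; first by rewrite exprn_ge0 // ltW.
  by have := sqr_ge0 am; have := sqr_ge0 e'; lra.
have prod : 4 * am * (vi - ui) + 4 * n%:R^-1 * ((ui + vi) / 2) =
   4 * al i.+1 * vi - 4 * al i * ui + 8 * n%:R^-1 * ((ui + vi) / 2).
  by rewrite /am alS; field; rewrite ?gt_eqF.
set Z := h * (_ / _); move: AM poly; rewrite -/Z.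
lra.
Qed.

End Collision.

(** * The discrete action and its lower bound on symmetric loops *)

Section Action.
Context (R : realType).
Implicit Types (d : R) (x y : nat -> R) (m n i j : nat).

(** The path is recorded by x and y at the times i / m of [0, 1]; the third
coordinate is y read backwards. *)
Definition rho d x y i : R := soft_norm d (x i) (y i).
Definition rho_yz m d y i : R := soft_norm d (y i) (y (m - i)%N).

Definition xy_action m d x y : R := \sum_(i < m)
  (((x i.+1 - x i) ^+ 2 + (y i.+1 - y i) ^+ 2) * m%:R +
   m%:R^-1 / 2 * ((rho d x y i)^-1 + (rho d x y i.+1)^-1)).
Definition yz_action m d y : R := \sum_(i < m)
  (2 * (y i.+1 - y i) ^+ 2 * m%:R +
   m%:R^-1 / 2 * ((rho_yz m d y i)^-1 + (rho_yz m d y i.+1)^-1)).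
Definition action m d x y : R := 2 * xy_action m d x y + yz_action m d y.

(** The value of y at time 1 is 0 because y is to be extended as an odd function
about 1; the second condition makes x odd about 1/2. *)
Definition admissible m x y : Prop :=
  y m = 0 /\ forall i, (i <= m)%N -> x (m - i)%N = - x i.

Definition energy m x : R := m%:R * \sum_(i < m) (x i.+1 - x i) ^+ 2.

Lemma energy_ge0 m x : 0 <= energy m x.
Proof. by rewrite mulr_ge0 // sumr_ge0 // => i _; rewrite sqr_ge0. Qed.

Lemma sqr_sum_increments n (a : nat -> R) :
  (a n - a 0%N) ^+ 2 <= n%:R * \sum_(i < n) (a i.+1 - a i) ^+ 2.
Proof.
elim: n => [|n IH]; first by rewrite subrr expr0n mul0r.
rewrite big_ord_recr /=; set S := \sum_(i < n) _ in IH *.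
have S0 : 0 <= S by rewrite sumr_ge0 // => i _; rewrite sqr_ge0.
have -> : a n.+1 - a 0%N = (a n - a 0%N) + (a n.+1 - a n) by ring.
set u := a n - _ in IH *; set v := a n.+1 - _.
have [n0|n0] := posnP n.
  move: IH; rewrite n0 mul0r => IH.
  have -> : u = 0 by apply/eqP; rewrite -sqrf_eq0 eq_le IH sqr_ge0.
  by rewrite add0r mul1r lerDr.
have N0 : 0 < n%:R :> R by rewrite ltr0n.
rewrite -natr1 -subr_ge0 -(pmulr_rge0 _ N0).
have -> : n%:R * ((n%:R + 1) * (S + v ^+ 2) - (u + v) ^+ 2) =
  (n%:R + 1) * (n%:R * S - u ^+ 2) + (u - n%:R * v) ^+ 2 by ring.
by rewrite addr_ge0 ?sqr_ge0 // mulr_ge0 ?subr_ge0 // addr_ge0.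
Qed.

Lemma sqr_increment m i j (a : nat -> R) : (i <= j)%N -> (j <= m)%N ->
  (a j - a i) ^+ 2 * m%:R <= (j%:R - i%:R) * energy m a.
Proof.
move=> ij jm.
have := sqr_sum_increments (j - i) (fun l => a (i + l)%N).
rewrite /= addn0 subnKC // natrB // => H.
rewrite /energy mulrCA mulrC ler_wpM2l //; apply: le_trans H _.
rewrite ler_wpM2l ?subr_ge0 ?ler_nat //.
under eq_bigr do rewrite addnS.
rewrite -(big_mkord xpredT (fun l => (a l.+1 - a l) ^+ 2)).
rewrite -(big_mkord xpredT (fun l => (a (i + l).+1 - a (i + l)%N) ^+ 2)).
rewrite (big_cat_nat (leq0n i) (leq_trans ij jm)) /=.
rewrite (big_cat_nat ij jm) /= (big_addn 0 j i).
under [X in _ <= _ + (X + _)]eq_bigr do rewrite addnC.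
have s0 p q : 0 <= \sum_(p <= l < q) (a l.+1 - a l) ^+ 2.
  by rewrite sumr_ge0 // => l _; rewrite sqr_ge0.
have := s0 0%N i; have := s0 j m; lra.
Qed.

Lemma admissible_y_bound m i x y : admissible m x y -> (i <= m)%N ->
  y i ^+ 2 * m%:R <= (m%:R - i%:R) * energy m y.
Proof.
move=> [ym _] im; have := sqr_increment y im (leqnn m).
by rewrite ym sub0r sqrrN.
Qed.

Lemma admissible_x_bound m i x y : admissible m x y -> (i <= m)%N ->
  4 * x i ^+ 2 <= energy m x.
Proof.
move=> [_ xm]; have [m0|m0] := posnP m.
  subst m; rewrite leqn0 => /eqP ->; have := xm 0%N (leqnn 0).
  rewrite subn0 => x0.
  have -> : x 0%N = 0 by lra.
  by rewrite expr0n /= mulr0 energy_ge0.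
have M0 : 0 < m%:R :> R by rewrite ltr0n.
wlog : i / (i <= m - i)%N => [H im|H im].
  have [/H->//|/ltnW H'] := leqP i (m - i).
  have := H (m - i)%N; rewrite subKn // xm // sqrrN; apply => //.
  exact: leq_subr.
have := sqr_increment x H (leq_subr i m).
rewrite xm // natrB // => X.
rewrite -(ler_pM2r M0).
have -> : 4 * x i ^+ 2 * m%:R = (- x i - x i) ^+ 2 * m%:R by ring.
apply: le_trans X _; rewrite mulrC ler_wpM2l ?energy_ge0 //.
by have := ler0n R i; lra.
Qed.

(** The graph of 1/r lies above 3 l / 2 - l^3 r^2 / 2, the tangent of 1/r as a
function of r^2 at r = 1 / l.  With l^3 <= 4 the slope is at most 2, so that in the
bounds of the action below the mean of r^2 is absorbed by the kinetic energy. *)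
Lemma inv_tangent (l r : R) : 0 <= l -> l ^+ 3 <= 4 -> 0 < r ->
  3 / 2 * l - 2 * r ^+ 2 <= r^-1.
Proof.
move=> l0 l4 r0; rewrite -[r^-1]mul1r ler_pdivlMr //.
have r3 : 0 <= r ^+ 3 by rewrite exprn_ge0 // ltW.
have : 0 <= (l * r - 1) ^+ 2 * (l * r + 2).
  by rewrite mulr_ge0 ?sqr_ge0 // addr_ge0 // mulr_ge0 // ltW.
have := ler_wpM2r r3 l4; lra.
Qed.

Lemma xy_action_split m d x y : (0 < m)%N -> xy_action m d x y =
  energy m x + energy m y +
  \sum_(i < m) (m%:R^-1 / 2 * ((rho d x y i)^-1 + (rho d x y i.+1)^-1)).
Proof.
move=> m0; rewrite /xy_action big_split /= /energy; congr (_ + _).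
by rewrite -mulrDr -big_split /= mulrC big_distrl.
Qed.

Lemma yz_action_split m d y : (0 < m)%N -> yz_action m d y = 2 * energy m y +
  \sum_(i < m) (m%:R^-1 / 2 * ((rho_yz m d y i)^-1 + (rho_yz m d y i.+1)^-1)).
Proof.
move=> m0; rewrite /yz_action big_split /= /energy; congr (_ + _).
by rewrite mulrA [2 * _]mulrC -mulrA mulr_sumr mulrC mulr_suml; apply: eq_bigr => i _.
Qed.

(** Since x vanishes at 1/2 and y at 1, the mean of x^2 + y^2 is at most
E/4 + F/2, where E and F are the energies of x and y; hence the potential term
is at least 3 l / 2 - E - F - 2 d^2. *)
Lemma xy_action_quarter m d x y (l : R) : (0 < m)%N -> 0 < d ->
  admissible m x y -> 0 <= l -> l ^+ 3 <= 4 ->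
  3 / 2 * l - 2 * d ^+ 2 <= xy_action m d x y.
Proof.
move=> m0 d0 adm l0 l4; rewrite xy_action_split //.
have M0 : 0 < m%:R :> R by rewrite ltr0n.
set E := energy m x; set F := energy m y.
have lb i : (i <= m)%N ->
    3 / 2 * l - 2 * (E / 4 + (1 - i%:R / m%:R) * F + d ^+ 2) <= (rho d x y i)^-1.
  move=> im; apply: le_trans (inv_tangent l0 l4 (soft_norm_gt0 _ _ d0)).
  rewrite sqr_soft_norm; have := admissible_x_bound adm im.
  have := admissible_y_bound adm im; rewrite -ler_pdivlMr // -/E -/F.
  have -> : (m%:R - i%:R) * F / m%:R = (1 - i%:R / m%:R) * F.
    by field; rewrite gt_eqF.
  lra.
pose c := 3 / 2 * l - 2 * (E / 4 + F + d ^+ 2).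
have := @telescope_le R (fun i => m%:R^-1 / 2 * ((rho d x y i)^-1 + (rho d x y i.+1)^-1))
  (fun i => i%:R / m%:R * c + (i%:R / m%:R) ^+ 2 * F) m.
rewrite /= !mul0r expr0n /= mul0r addr0 subr0 divff ?gt_eqF // expr1n !mul1r => H.
suff : c + F <= \sum_(i < m) m%:R^-1 / 2 * ((rho d x y i)^-1 + (rho d x y i.+1)^-1).
  rewrite /c; have : 0 <= E by exact: energy_ge0.
  lra.
apply: H => i im; have := lb i (ltnW im); have := lb i.+1 im.
rewrite -natr1 mulrDl mul1r => A B.
have e0 : 0 < m%:R^-1 :> R by rewrite invr_gt0.
have := ler_wpM2l (ltW e0) (lerD A B); rewrite /c; lra.
Qed.

(** Here the bounds y(t)^2 <= (1 - t) F and z(t)^2 <= t F add up to F. *)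
Lemma yz_action_quarter m d x y (l : R) : (0 < m)%N -> 0 < d ->
  admissible m x y -> 0 <= l -> l ^+ 3 <= 4 ->
  3 / 2 * l - 2 * d ^+ 2 <= yz_action m d y.
Proof.
move=> m0 d0 adm l0 l4; rewrite yz_action_split //.
have M0 : 0 < m%:R :> R by rewrite ltr0n.
set F := energy m y.
have lb i : (i <= m)%N -> 3 / 2 * l - 2 * (F + d ^+ 2) <= (rho_yz m d y i)^-1.
  move=> im; apply: le_trans (inv_tangent l0 l4 (soft_norm_gt0 _ _ d0)).
  rewrite sqr_soft_norm.
  have := admissible_y_bound adm im.
  have := admissible_y_bound adm (leq_subr i m); rewrite natrB //.
  rewrite -!(ler_pdivlMr _ _ M0) -/F.
  have -> : (m%:R - i%:R) * F / m%:R = (1 - i%:R / m%:R) * F.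
    by field; rewrite gt_eqF.
  have -> : (m%:R - (m%:R - i%:R)) * F / m%:R = i%:R / m%:R * F.
    by field; rewrite gt_eqF.
  lra.
pose c := 3 / 2 * l - 2 * (F + d ^+ 2).
have := @telescope_le R (fun i => m%:R^-1 / 2 * ((rho_yz m d y i)^-1 + (rho_yz m d y i.+1)^-1))
  (fun i => i%:R / m%:R * c) m.
rewrite /= !mul0r subr0 divff ?gt_eqF // !mul1r => H.
suff : c <= \sum_(i < m) m%:R^-1 / 2 * ((rho_yz m d y i)^-1 + (rho_yz m d y i.+1)^-1).
  by rewrite /c; lra.
apply: H => i im; have := lb i (ltnW im); have := lb i.+1 im.
rewrite -natr1 mulrDl mul1r => A B.
have e0 : 0 < m%:R^-1 :> R by rewrite invr_gt0.
have := ler_wpM2l (ltW e0) (lerD A B); rewrite /c; lra.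
Qed.
End Action.

(** * Low action excludes near collisions *)

Section Level.
Context (R : realType).
Implicit Types (d : R) (x y : nat -> R) (m n i j : nat).

(** A path that meets the collision in between is two paths that leave it, one of
them with time reversed. *)
Lemma collision_bound_mid m j (h K s : R) (r : nat -> R) :
  0 < h -> 0 <= s -> s ^+ 3 <= 2 * K -> K * (m%:R * h) <= 1 -> (j <= m)%N ->
  (forall i, (i <= m)%N -> 0 < r i) ->
  34 / 15 * s ^+ 2 * (m%:R * h) - 8 * Num.sqrt (r j) <=
  \sum_(i < m) ((r i.+1 - r i) ^+ 2 / h + h / 2 * ((r i)^-1 + (r i.+1)^-1)).
Proof.
move=> h0 s0 sK Km jm rpos.
have K0 : 0 <= K by have := exprn_ge0 3 s0; lra.
have Kn n : (n <= m)%N -> K * (n%:R * h) <= 1.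
  move=> nm; apply: le_trans Km; rewrite ler_wpM2l // ler_wpM2r ?ler_nat //.
  exact: ltW.
pose F i := (r i.+1 - r i) ^+ 2 / h + h / 2 * ((r i)^-1 + (r i.+1)^-1).
rewrite -(big_mkord xpredT F) (big_cat_nat (leq0n j) jm) /=.
have right : 34 / 15 * s ^+ 2 * ((m - j)%:R * h) - 4 * Num.sqrt (r j) <=
    \sum_(j <= i < m) F i.
  have := @collision_bound R (m - j) h K s (fun i => r (j + i)%N) h0 s0 sK.
  rewrite addn0 -{1}[j in \sum_(j <= i < m) F i]add0n big_addn big_mkord.
  move=> /(_ (Kn _ (leq_subr _ _))) H; apply: le_trans (H _) _.
    by move=> i im; apply: rpos; rewrite -(subnKC jm) leq_add2l.
  by rewrite le_eqVlt; apply/orP; left; apply/eqP; apply: eq_bigr => i _;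
    rewrite /F addnS addnC.
have left : 34 / 15 * s ^+ 2 * (j%:R * h) - 4 * Num.sqrt (r j) <=
    \sum_(0 <= i < j) F i.
  have := @collision_bound R j h K s (fun i => r (j - i)%N) h0 s0 sK (Kn _ jm).
  rewrite subn0 big_mkord => H; apply: le_trans (H _) _.
    by move=> i _; apply: rpos; apply: leq_trans jm; exact: leq_subr.
  rewrite (reindex_inj rev_ord_inj) /=.
  rewrite le_eqVlt; apply/orP; left; apply/eqP; apply: eq_bigr => i _.
  rewrite /F subnSK // !subKn ?(ltnW (ltn_ord i)) //.
  by rewrite -sqrrN opprB [X in _ + h / 2 * X]addrC.
move: right left; rewrite natrB //.
set A := \sum_(_ <= _ < _) _; set B := \sum_(_ <= _ < _) _; lra.
Qed.

Lemma xy_action_collision m j d x y (s : R) : (0 < m)%N -> 0 < d ->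
  0 <= s -> s ^+ 3 <= 2 -> (j <= m)%N ->
  34 / 15 * s ^+ 2 - 8 * Num.sqrt (rho d x y j) <= xy_action m d x y.
Proof.
move=> m0 d0 s0 s2 jm.
have M0 : 0 < m%:R :> R by rewrite ltr0n.
have h0 : 0 < m%:R^-1 :> R by rewrite invr_gt0.
have mh : m%:R * m%:R^-1 = 1 :> R by rewrite divff ?gt_eqF.
have := @collision_bound_mid m j m%:R^-1 1 s (rho d x y) h0 s0.
rewrite mh !mulr1 => /(_ s2 (lexx 1) jm) H; apply: le_trans (H _) _.
  by move=> i _; exact: soft_norm_gt0.
apply: ler_sum => i _; rewrite lerD2r invrK.
by apply: ler_wpM2r; [exact: ltW|exact: soft_norm_lip].
Qed.

(** By the symmetry t |-> 1 - t there are two collisions, one in each half.  On a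
half the slope can decrease at rate 2, which is why s^3 <= 4 suffices; the
number of steps is even so that 1/2 is a grid point. *)
Lemma yz_action_collision n j d y (s : R) : (0 < n)%N -> 0 < d ->
  0 <= s -> s ^+ 3 <= 4 -> (j <= n.*2)%N ->
  34 / 15 * s ^+ 2 - 16 * Num.sqrt (rho_yz n.*2 d y j) <= yz_action n.*2 d y.
Proof.
move=> n0 d0 s0 s4; set m := n.*2.
have m0 : (0 < m)%N by rewrite double_gt0.
have M0 : 0 < m%:R :> R by rewrite ltr0n.
have h0 : 0 < m%:R^-1 :> R by rewrite invr_gt0.
have mh : m%:R = 2 * n%:R :> R by rewrite -natrM mul2n.
have sym i : (i <= m)%N -> rho_yz m d y (m - i) = rho_yz m d y i.
  by move=> im; rewrite /rho_yz subKn // /soft_norm [X in X + _]addrC.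
wlog jn : j / (j <= n)%N => [H jm|_].
  have [/H H'|/ltnW nj] := leqP j n; first exact: H'.
  rewrite -sym //; apply: H; last exact: leq_subr.
  by rewrite leq_subLR /m -addnn leq_add2r.
pose F i := (rho_yz m d y i.+1 - rho_yz m d y i) ^+ 2 / m%:R^-1 +
  m%:R^-1 / 2 * ((rho_yz m d y i)^-1 + (rho_yz m d y i.+1)^-1).
have half : \sum_(i < m) F i = 2 * \sum_(i < n) F i.
  rewrite -(big_mkord xpredT F) (big_cat_nat (leq0n n) (_ : n <= m)%N) /=; last first.
    by rewrite /m -addnn leq_addr.
  rewrite -{2}[n]add0n big_addn /m -addnn addnK !big_mkord mulr2n mulrDl mul1r.
  congr (_ + _); rewrite (reindex_inj rev_ord_inj) /=; apply: eq_bigr => i _.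
  have lti := ltn_ord i.
  have i2 : (n - i.+1 + n = m - i.+1)%N by rewrite /m; lia.
  have i3 : ((m - i.+1).+1 = m - i)%N by rewrite /m; lia.
  rewrite i2 /F i3 !sym; try by rewrite /m; lia.
  by rewrite -sqrrN opprB [X in _ + _ / 2 * X]addrC.
have := @collision_bound_mid n j m%:R^-1 2 s (rho_yz m d y) h0 s0.
have -> : n%:R * m%:R^-1 = 1 / 2 :> R.
  by rewrite mh; field; rewrite gt_eqF // ltr0n.
have -> : 2 * 2 = 4 :> R by ring.
move=> /(_ s4) H.
have {}H : 34 / 15 * s ^+ 2 * (1 / 2) - 8 * Num.sqrt (rho_yz m d y j) <=
   \sum_(i < n) F i.
  by apply: H => //; [lra|move=> i _; exact: soft_norm_gt0].
have : \sum_(i < m) F i <= yz_action m d y.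
  rewrite yz_action_split // /F big_split /= lerD2r.
  apply: (@le_trans _ _ (\sum_(i < m) ((y i.+1 - y i) ^+ 2 * m%:R +
     (y (m - i.+1)%N - y (m - i)%N) ^+ 2 * m%:R))).
    apply: ler_sum => i _; rewrite invrK -mulrDl.
    by apply: ler_wpM2r; [exact: ltW|exact: soft_norm_lip].
  rewrite big_split /= [X in _ + X](reindex_inj rev_ord_inj) /=.
  rewrite [X in _ + X](_ : _ = \sum_(i < m) (y i.+1 - y i) ^+ 2 * m%:R).
    by rewrite -mulr_suml /energy; lra.
  apply: eq_bigr => i _; rewrite -sqrrN opprB.
  by congr ((y _ - y _) ^+ 2 * _); have := ltn_ord i; lia.
rewrite half; lra.
Qed.

(** The level 237/25 = 9.48 lies between the action of the explicit loop and the
least action of a loop with a collision. *)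
Lemma no_near_collision n j d x y : (0 < n)%N -> 0 < d -> d <= 1 / 100 ->
  admissible n.*2 x y -> action n.*2 d x y <= 237 / 25 -> (j <= n.*2)%N ->
  1 / 1000 ^+ 2 <= rho d x y j /\ 1 / 1000 ^+ 2 <= rho_yz n.*2 d y j.
Proof.
move=> n0 d0 d1 adm act jm.
have m0 : (0 < n.*2)%N by rewrite double_gt0.
(* Rational lower bounds of 4^(1/3) and 2^(1/3). *)
pose l : R := 79 / 50; pose s : R := 157 / 125.
have l0 : 0 <= l by rewrite /l; lra.
have l4 : l ^+ 3 <= 4 by rewrite /l; lra.
have s0 : 0 <= s by rewrite /s; lra.
have s2 : s ^+ 3 <= 2 by rewrite /s; lra.
have d2 : d ^+ 2 <= 1 / 1000.
  by have := @ler_wpM2l R _ (ltW d0) _ _ d1; lra.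
have qxy := xy_action_quarter m0 d0 adm l0 l4.
have qyz := yz_action_quarter m0 d0 adm l0 l4.
have cxy := xy_action_collision x y m0 d0 s0 s2 jm.
have cyz := yz_action_collision y n0 d0 l0 l4 jm.
rewrite /action in act.
have sq (r : R) : 0 <= r -> r < 1 / 1000 ^+ 2 -> Num.sqrt r <= 1 / 1000.
  move=> r0 r1; have t0 : 0 <= 1 / 1000 :> R by lra.
  rewrite -[leRHS](ger0_norm t0) -sqrtr_sqr ler_wsqrtr //.
  lra.
split; rewrite leNgt; apply/negP => /sq H.
  have {}H : Num.sqrt (rho d x y j) <= 1 / 1000 by apply: H; exact: sqrtr_ge0.
  by move: qyz cxy; rewrite /s /l; lra.
have {}H : Num.sqrt (rho_yz n.*2 d y j) <= 1 / 1000 by apply: H; exact: sqrtr_ge0.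
by move: qxy cyz; rewrite /l; lra.
Qed.

End Level.

(** * An explicit loop of low action *)

Section TestPath.
Context (R : realType).
Implicit Types (t : R).

Lemma bernstein_ge0 t : 0 <= t <= 1 ->
  forall i j : nat, 0 <= t ^+ i * (1 - t) ^+ j.
Proof.
by move=> /andP[t0 t1] i j; rewrite mulr_ge0 // exprn_ge0 // subr_ge0.
Qed.

(** The inequality 1 <= (U rho)^2 for the polynomial bound U of 1 / rho along the
explicit loop, with denominators cleared.  On each third of [0, 1] the difference
is a combination of Bernstein polynomials with positive coefficients. *)
Lemma test_potential_poly t : 0 <= t <= 1 ->
  300 ^+ 2 <= (14 + 5 * t + 5 * t ^+ 2 + 25 * t ^+ 3) ^+ 2 *
    (81 * (1 - 2 * t) ^+ 2 + 400 * (1 - t ^+ 2) ^+ 2).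
Proof.
move=> t01.
have cell (k : R) : 0 <= 3 * t - k <= 1 -> (k = 0 \/ k = 1 \/ k = 2) ->
    300 ^+ 2 <= (14 + 5 * t + 5 * t ^+ 2 + 25 * t ^+ 3) ^+ 2 *
    (81 * (1 - 2 * t) ^+ 2 + 400 * (1 - t ^+ 2) ^+ 2).
  move=> /bernstein_ge0 B kk.
  have h0 := B 0%N 10; have h1 := B 1%N 9; have h2 := B 2 8; have h3 := B 3 7.
  have h4 := B 4 6; have h5 := B 5 5; have h6 := B 6 4; have h7 := B 7 3.
  have h8 := B 8 2; have h9 := B 9 1%N; have h10 := B 10 0%N.
  by move: h0 h1 h2 h3 h4 h5 h6 h7 h8 h9 h10; case: kk => [->|[->|->]]; clear; lra.
have [a|a] := lerP (3 * t) 1; first by apply: (cell 0); [lra|left].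
have [b|b] := lerP (3 * t) 2; first by apply: (cell 1); [lra|right; left].
by apply: (cell 2); [lra|right; right].
Qed.

(** Near the minimum of the action among loops given by such simple polynomials. *)
Definition test_x m (i : nat) : R := 3 / 10 * (1 - 2 * (i%:R / m%:R)).
Definition test_y m (i : nat) : R := 2 / 3 * (1 - (i%:R / m%:R) ^+ 2).

Lemma test_admissible m : (0 < m)%N -> admissible m (test_x m) (test_y m).
Proof.
move=> m0; have M0 : m%:R != 0 :> R by rewrite pnatr_eq0 -lt0n.
split=> [|i im]; first by rewrite /test_y divff // expr1n subrr mulr0.
by rewrite /test_x natrB //; field.
Qed.

Lemma inv_le_of_sqr (U r : R) : 0 <= U -> 0 < r -> 1 <= U ^+ 2 * r ^+ 2 -> r^-1 <= U.
Proof.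
move=> U0 r0 H; rewrite -[leLHS]mul1r ler_pdivrMr //.
have Ur : 0 <= U * r by rewrite mulr_ge0 // ltW.
by rewrite -(@ler_pXn2r _ 2) ?nnegrE // expr1n exprMn.
Qed.

(** An upper bound of 1 / rho along the explicit loop; its coefficients are
nonnegative, so that its left Riemann sums lie below its integral. *)
Let U t : R := 7 / 5 + t / 2 + t ^+ 2 / 2 + 5 / 2 * t ^+ 3.

(** The action is bounded by 0.72 + 64/27 + 3/2 plus twice the integral
of U, which is less than 9.474, up to 7 / m.
The second distance is at least 2/3, because
(1 - t^2)^2 + (2 t - t^2)^2 = 1 + 2 t^2 (1 - t)^2. *)
Lemma test_action m (d : R) : (1200 <= m)%N -> 0 < d ->
  action m d (test_x m) (test_y m) <= 237 / 25.
Proof.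
move=> m1 d0; have m0 : (0 < m)%N by apply: leq_trans m1.
have M0 : 0 < m%:R :> R by rewrite ltr0n.
set e := m%:R^-1 : R; have e0 : 0 < e by rewrite invr_gt0.
pose t (i : nat) : R := i%:R * e.
have t01 i : (i <= m)%N -> 0 <= t i <= 1.
  move=> im; rewrite mulr_ge0 ?(ltW e0) //=.
  by rewrite /t /e ler_pdivrMr // mul1r ler_nat.
have tS i : t i.+1 = t i + e by rewrite /t -natr1 mulrDl mul1r.
have Ule i : (i <= m)%N -> (rho d (test_x m) (test_y m) i)^-1 <= U (t i).
  move=> im; have /andP[t0 t1] := t01 _ im.
  have t2 : 0 <= t i ^+ 2 by exact: sqr_ge0.
  have t3 : 0 <= t i ^+ 3 by exact: exprn_ge0.
  apply: inv_le_of_sqr; [by rewrite /U; lra|exact: soft_norm_gt0|].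
  rewrite sqr_soft_norm /test_x /test_y -/e -/(t i).
  have := test_potential_poly (t01 _ im).
  have := sqr_ge0 (U (t i) * d); rewrite /U; move: (t i) => z; lra.
have Rle i : (i <= m)%N -> (rho_yz m d (test_y m) i)^-1 <= 3 / 2.
  move=> im; have /andP[t0 t1] := t01 _ im.
  apply: inv_le_of_sqr; [by lra|exact: soft_norm_gt0|].
  rewrite sqr_soft_norm /test_y -/e -/(t i).
  have -> : (m - i)%:R * e = 1 - t i.
    by rewrite natrB // mulrBl /e divff ?gt_eqF.
  have := sqr_ge0 d; have := sqr_ge0 (t i * (1 - t i)).
  move: (t i) => z; lra.
(* A primitive of the bound of the integrand; the term e * U z accounts for the
   right end points of the trapezoid rule. *)
pose G (z : R) := 18 / 25 * z + 64 / 27 * z ^+ 3 +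
  2 * (7 / 5 * z + z ^+ 2 / 4 + z ^+ 3 / 6 + 5 / 8 * z ^+ 4) + e * U z + 3 / 2 * z.
have step i : (i < m)%N ->
  2 * (((test_x m i.+1 - test_x m i) ^+ 2 + (test_y m i.+1 - test_y m i) ^+ 2) * m%:R
   + e / 2 * ((rho d (test_x m) (test_y m) i)^-1
     + (rho d (test_x m) (test_y m) i.+1)^-1)) +
  (2 * (test_y m i.+1 - test_y m i) ^+ 2 * m%:R
   + e / 2 * ((rho_yz m d (test_y m) i)^-1 + (rho_yz m d (test_y m) i.+1)^-1))
  <= G (t i.+1) - G (t i).
  move=> im; have A := lerD (Ule _ (ltnW im)) (Ule _ im).
  have B := lerD (Rle _ (ltnW im)) (Rle _ im).
  have {}A := ler_wpM2l (ltW e0) A; have {}B := ler_wpM2l (ltW e0) B.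
  have /andP[t0 _] := t01 _ (ltnW im).
  have kin : ((test_x m i.+1 - test_x m i) ^+ 2 + 2 * (test_y m i.+1 - test_y m i) ^+ 2)
     * m%:R = 9 / 25 * e + 8 / 9 * (2 * t i + e) ^+ 2 * e.
    rewrite /test_x /test_y -/e -/(t i) -/(t i.+1) tS.
    have -> : m%:R = e^-1 :> R by rewrite /e invrK.
    by field; rewrite gt_eqF.
  have q1 : 0 <= e ^+ 3 by rewrite exprn_ge0 // ltW.
  have q2 : 0 <= e ^+ 2 * t i by rewrite mulr_ge0 // sqr_ge0.
  have q3 : 0 <= (e * t i) ^+ 2 by rewrite sqr_ge0.
  have q4 : 0 <= e ^+ 3 * t i by rewrite mulr_ge0.
  have q5 : 0 <= e ^+ 2 by rewrite sqr_ge0.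
  have q6 : 0 <= e ^+ 4 by rewrite exprn_ge0 // ltW.
  rewrite /G tS; move: A B kin; rewrite tS /U.
  move: (t i) q2 q3 q4 => z *; lra.
have H : action m d (test_x m) (test_y m) <= G (t m) - G (t 0%N).
  rewrite /action /xy_action /yz_action mulr_sumr -big_split /=.
  exact: (@telescope_ge R _ (fun i => G (t i)) m step).
apply: le_trans H _; rewrite /t mul0r /e divff ?gt_eqF // -/e /G /U.
have e1 : e * 1200 <= 1.
  rewrite /e mulrC ler_pdivrMr // mul1r.
  by rewrite (ler_nat R 1200).
lra.
Qed.

End TestPath.

(** * Ultrafilter limits and existence of minimisers *)

Section UltraLimits.
Context (R : realType).

(** Limits along such an ultrafilter exist for all bounded sequences at once, which
replaces the extraction of subsequences. *)
Lemma exists_ultrafilter_infty :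
  exists U : set_system nat, UltraFilter U /\ \oo `<=` U.
Proof. exact: ultraFilterLemma. Qed.

Lemma ultra_fmap (T V : Type) (f : T -> V) (F : set_system T) :
  UltraFilter F -> UltraFilter (f @ F).
Proof.
move=> UF; split=> [|G GF FG]; first exact: fmap_proper_filter.
apply/seteqP; split=> // A GA.
have [//|nA] := in_ultra_setVsetC (f @^-1` A) UF.
have GnA : G (~` A) by exact: FG.
by have := @filter_ex _ _ GF _ (filterI GA GnA) => -[? []].
Qed.

Lemma ultra_bounded_cvg (F : set_system nat) (u : nat -> R) (B : R) :
  UltraFilter F -> (\forall n \near F, `|u n| <= B) -> exists l : R, u @ F --> l.
Proof.
move=> UF uB.
have := @segment_compact R (- B) B; rewrite compact_ultra.
move=> /(_ _ (ultra_fmap u UF)) H.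
have [|l [_ Hl]] := H; last by exists l.
by apply: filterS uB => n /=; rewrite ler_norml in_itv.
Qed.

Lemma cvg_real_unique (T : Type) (F : set_system T) (u : T -> R) (a b : R) :
  ProperFilter F -> u @ F --> a -> u @ F --> b -> a = b.
Proof. by move=> FF; exact: (@cvg_unique _ (@norm_hausdorff _ R)). Qed.

Lemma cvg_sum_ord (T : Type) (F : set_system T) n (f : nat -> T -> R) (l : nat -> R) :
  Filter F -> (forall i, (i < n)%N -> f i @ F --> l i) ->
  (fun t => \sum_(i < n) f i t) @ F --> \sum_(i < n) l i.
Proof.
move=> FF; elim: n => [|n IH] H.
  rewrite big_ord0; under eq_fun do rewrite big_ord0; exact: cvg_cst.
rewrite big_ord_recr /=; under eq_fun do rewrite big_ord_recr /=.
by apply: cvgD; [apply: IH => i /ltnW; exact: H|exact: H].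
Qed.

Lemma cvg_soft_norm (T : Type) (F : set_system T) (f g e : T -> R) (a b d : R) :
  Filter F -> f @ F --> a -> g @ F --> b -> e @ F --> d ->
  (fun t => soft_norm (e t) (f t) (g t)) @ F --> soft_norm d a b.
Proof.
move=> FF fa gb ed; rewrite /soft_norm.
apply: continuous_cvg; first exact: sqrt_continuous.
apply: cvgD; last by under eq_fun do rewrite expr2; rewrite expr2; exact: cvgM.
by apply: cvgD; under eq_fun do rewrite expr2; rewrite expr2; exact: cvgM.
Qed.

(** The kinetic terms bound the values of a minimising sequence on the grid, so
these values converge along an ultrafilter; the action is continuous because
d > 0. *)
Lemma exists_minimiser m (d : R) : (0 < m)%N -> 0 < d ->
  exists x y : nat -> R, admissible m x y /\
    forall x' y', admissible m x' y' -> action m d x y <= action m d x' y'.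
Proof.
move=> m0 d0; have M0 : 0 < m%:R :> R by rewrite ltr0n.
pose S := [set v : R | exists x y, admissible m x y /\ v = action m d x y].
have pot_ge0 (r : nat -> R) : (forall i, 0 < r i) ->
    0 <= \sum_(i < m) (m%:R^-1 / 2 * ((r i)^-1 + (r i.+1)^-1)).
  move=> r0; rewrite sumr_ge0 // => i _.
  by rewrite mulr_ge0 ?divr_ge0 ?addr_ge0 ?invr_ge0 ?ltW.
have energy_le x y : energy m x <= action m d x y /\ energy m y <= action m d x y.
  rewrite /action xy_action_split // yz_action_split //.
  have := energy_ge0 m x; have := energy_ge0 m y.
  have := pot_ge0 _ (fun i => soft_norm_gt0 (x i) (y i) d0).
  have := pot_ge0 _ (fun i => soft_norm_gt0 (y i) (y (m - i)%N) d0).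
  rewrite /rho_yz /rho; split; lra.
have S_inf : has_inf S.
  split; first by exists (action m d (fun=> 0) (fun=> 0)), (fun=> 0), (fun=> 0);
    split=> //; split=> // i; rewrite oppr0.
  exists 0 => _ [x [y [_ ->]]]; apply: le_trans (energy_ge0 m x) _.
  by have [] := energy_le x y.
have seqs k : exists xy : (nat -> R) * (nat -> R), admissible m xy.1 xy.2 /\
    action m d xy.1 xy.2 < inf S + k.+1%:R^-1.
  have k0 : 0 < k.+1%:R^-1 :> R by [].
  by have [_ [x [y [A ->]]] H] := inf_adherent k0 S_inf; exists (x, y).
have [f Hf] := choice seqs.
have [F [UF Foo]] := exists_ultrafilter_infty.
set I := inf S in Hf.
have fle k : action m d (f k).1 (f k).2 <= I + 1.
  apply: ltW; apply: lt_le_trans (Hf k).2 _; rewrite lerD2l invf_le1 ?ler1n //.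
have sqb (u B : R) : u ^+ 2 <= B -> `|u| <= 1 + B.
  move=> uB; rewrite -real_normK ?num_real // in uB.
  by have := sqr_ge0 (`|u| - 1); have := normr_ge0 u; nra.
have xl i : exists l : R, (i <= m)%N -> (fun k => (f k).1 i) @ F --> l.
  have [im|_] := leqP i m; last by exists 0.
  have [|l Hl] := @ultra_bounded_cvg F (fun k => (f k).1 i) (1 + (I + 1)) UF;
    last by exists l.
  apply: nearW => k; apply: sqb; have := admissible_x_bound (Hf k).1 im.
  have := energy_ge0 m (f k).1; have := fle k.
  have [] := energy_le (f k).1 (f k).2; have := sqr_ge0 ((f k).1 i); lra.
have yl i : exists l : R, (i <= m)%N -> (fun k => (f k).2 i) @ F --> l.
  have [im|_] := leqP i m; last by exists 0.
  have [|l Hl] := @ultra_bounded_cvg F (fun k => (f k).2 i) (1 + (I + 1)) UF;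
    last by exists l.
  apply: nearW => k; apply: sqb; have := admissible_y_bound (Hf k).1 im.
  rewrite -ler_pdivlMr // => H; apply: le_trans H _.
  have E0 := energy_ge0 m (f k).2; have := fle k.
  have [_ e2] := energy_le (f k).1 (f k).2.
  have : (m%:R - i%:R) * energy m (f k).2 / m%:R <= energy m (f k).2.
    rewrite ler_pdivrMr // mulrC ler_wpM2l //; have := ler0n R i; lra.
  lra.
have [x Hx] := choice xl; have [y Hy] := choice yl.
exists x, y; split.
  split=> [|i im].
    apply: (cvg_real_unique _ (Hy m (leqnn m))).
    by under eq_fun do rewrite (Hf _).1.1; exact: cvg_cst.
  apply: (cvg_real_unique _ (Hx _ (leq_subr i m))).
  under eq_fun do rewrite (Hf _).1.2 //.
  by apply: cvgN; exact: Hx.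
move=> x' y' adm'.
have I_le : I <= action m d x' y' by apply: ge_inf; [exact: S_inf.2|exists x', y'].
apply: le_trans I_le.
have lim_act : (fun k => action m d (f k).1 (f k).2) @ F --> action m d x y.
  have cst (c : R) : (fun=> c) @ F --> c by exact: cvg_cst.
  have inv_pot (a b : nat -> R) (A B : R) : a @ F --> A -> b @ F --> B ->
      (fun k => (soft_norm d (a k) (b k))^-1) @ F --> (soft_norm d A B)^-1.
    by move=> aA bB; apply: cvgV; [rewrite gt_eqF // soft_norm_gt0|exact: cvg_soft_norm].
  have sqd (a b : nat -> R) (A B : R) : a @ F --> A -> b @ F --> B ->
      (fun k => (a k - b k) ^+ 2) @ F --> (A - B) ^+ 2.
    move=> aA bB; under eq_fun do rewrite expr2; rewrite expr2.
    by apply: cvgM; apply: cvgB.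
  rewrite /action; apply: cvgD; first apply: cvgM => //.
    pose T (x y : nat -> R) i : R := ((x i.+1 - x i) ^+ 2 + (y i.+1 - y i) ^+ 2) *
      m%:R + m%:R^-1 / 2 * ((rho d x y i)^-1 + (rho d x y i.+1)^-1).
    apply: (@cvg_sum_ord _ F m (fun i k => T (f k).1 (f k).2 i) (T x y)) => i im.
    apply: cvgD; apply: cvgM => //.
      by apply: cvgD; apply: sqd; (apply: Hx || apply: Hy) => //; exact: ltnW.
    by apply: cvgD; apply: inv_pot; (apply: Hx || apply: Hy) => //; exact: ltnW.
  pose T (y : nat -> R) i : R := 2 * (y i.+1 - y i) ^+ 2 * m%:R +
    m%:R^-1 / 2 * ((rho_yz m d y i)^-1 + (rho_yz m d y i.+1)^-1).
  apply: (@cvg_sum_ord _ F m (fun i k => T (f k).2 i) (T y)) => i im.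
  apply: cvgD; apply: cvgM => //.
    by apply: cvgM => //; apply: sqd; apply: Hy => //; exact: ltnW.
  by apply: cvgD; apply: inv_pot; apply: Hy => //; first exact: ltnW; exact: leq_subr.
have lim_I : (fun k : nat => I + k.+1%:R^-1) @ F --> I.
  rewrite -[X in _ --> X]addr0; apply: cvgD; first exact: cvg_cst.
  apply: cvg_trans (@cvg_harmonic R); exact: cvg_app.
apply: (ler_cvg_to lim_act lim_I); apply: nearW => k; exact: ltW (Hf k).2.
Qed.
End UltraLimits.

(** * Discrete Euler-Lagrange equations *)

Section EulerLagrange.
Context (R : realType).
Implicit Types (d : R) (x y : nat -> R) (m n i j : nat).

(** From the identity
1/r' = 1/r - (r'^2 - r^2) / (2 r^3) + (r' - r)^2 (2 r + r') / (2 r^3 r')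
and the Lipschitz bound for r' - r. *)
Lemma inv_soft_norm_taylor d (x y a b s : R) : 0 < d ->
  (soft_norm d (x + s * a) (y + s * b))^-1 <=
  (soft_norm d x y)^-1 - s * ((x * a + y * b) / soft_norm d x y ^+ 3) +
  s ^+ 2 * ((a ^+ 2 + b ^+ 2) * ((soft_norm d x y ^+ 2 * d)^-1 +
                                 (2 * soft_norm d x y ^+ 3)^-1)).
Proof.
move=> d0; have r0 := soft_norm_gt0 x y d0.
have r'0 := soft_norm_gt0 (x + s * a) (y + s * b) d0.
have E := sqr_soft_norm d x y; have E' := sqr_soft_norm d (x + s * a) (y + s * b).
have := soft_norm_lip d (x + s * a) (y + s * b) x y.
set r := soft_norm d x y in r0 E *; set r' := soft_norm d (x + _) _ in r'0 E' * => L.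
have rd : d <= r'.
  rewrite -(@ler_pXn2r _ 2) ?nnegrE ?(ltW d0) ?(ltW r'0) // E'.
  by rewrite lerDr addr_ge0 ?sqr_ge0.
have id : r'^-1 = r^-1 - (r' ^+ 2 - r ^+ 2) / (2 * r ^+ 3) +
    (r' - r) ^+ 2 * ((r ^+ 2 * r')^-1 + (2 * r ^+ 3)^-1).
  by field; rewrite !gt_eqF.
have -> : (x * a + y * b) / r ^+ 3 = 2 * (x * a + y * b) / (2 * r ^+ 3).
  by field; rewrite gt_eqF.
have k0 : 0 < (2 * r ^+ 3)^-1 by rewrite invr_gt0 mulr_gt0 // exprn_gt0.
have l0 : 0 < r ^+ 2 by rewrite exprn_gt0.
have kk : (r ^+ 2 * r')^-1 <= (r ^+ 2 * d)^-1.
  by rewrite lef_pV2 ?posrE ?mulr_gt0 // ler_pM2l.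
have l1 : 0 < (r ^+ 2 * r')^-1 by rewrite invr_gt0 mulr_gt0.
rewrite [leLHS]id.
have D : r' ^+ 2 - r ^+ 2 = s * (2 * (x * a + y * b)) + s ^+ 2 * (a ^+ 2 + b ^+ 2).
  by rewrite E E'; ring.
rewrite D.
have L' : (r' - r) ^+ 2 <= s ^+ 2 * (a ^+ 2 + b ^+ 2).
  by apply: le_trans L _; rewrite le_eqVlt; apply/orP; left; apply/eqP; ring.
have S0 : 0 <= s ^+ 2 * (a ^+ 2 + b ^+ 2).
  by rewrite mulr_ge0 ?sqr_ge0 // addr_ge0 ?sqr_ge0.
have A1 : (r' - r) ^+ 2 * ((r ^+ 2 * r')^-1 + (2 * r ^+ 3)^-1) <=
  s ^+ 2 * (a ^+ 2 + b ^+ 2) * ((r ^+ 2 * d)^-1 + (2 * r ^+ 3)^-1).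
  by apply: ler_pM; rewrite ?sqr_ge0 ?lerD2r // addr_ge0 // ltW.
have A2 : 0 <= s ^+ 2 * (a ^+ 2 + b ^+ 2) * (2 * r ^+ 3)^-1.
  by rewrite mulr_ge0 // ltW.
move: A1 A2; set P := (2 * r ^+ 3)^-1; set Q := (r ^+ 2 * d)^-1.
set Q' := (r ^+ 2 * r')^-1; lra.
Qed.

Lemma stationary_of_quadratic_bound (A B : R) :
  (forall s, 0 <= s * A + s ^+ 2 * B) -> A = 0.
Proof.
move=> H; pose C := 1 + `|B|; have C0 : 0 < C by rewrite ltr_pwDl.
have := H (- A / C); have -> : (- A / C) * A + (- A / C) ^+ 2 * B =
  - (A ^+ 2 * (C - B)) / C ^+ 2 by field; rewrite gt_eqF.
rewrite pmulr_lge0 ?invr_gt0 ?exprn_gt0 // oppr_ge0 pmulr_lle0; last first.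
  by rewrite /C; have := ler_norm B; lra.
by move=> A0; apply/eqP; rewrite -sqrf_eq0 eq_le A0 sqr_ge0.
Qed.

(** The coefficient of s in the action at (x + s a, y + s b). *)
Definition first_variation m d x y (a b : nat -> R) : R := \sum_(i < m)
  ((4 * ((x i.+1 - x i) * (a i.+1 - a i)) + 8 * ((y i.+1 - y i) * (b i.+1 - b i))) * m%:R
   - m%:R^-1 / 2 * (2 * ((x i * a i + y i * b i) / rho d x y i ^+ 3
                       + (x i.+1 * a i.+1 + y i.+1 * b i.+1) / rho d x y i.+1 ^+ 3)
       + ((y i * b i + y (m - i)%N * b (m - i)%N) / rho_yz m d y i ^+ 3 +
          (y i.+1 * b i.+1 + y (m - i.+1)%N * b (m - i.+1)%N) / rho_yz m d y i.+1 ^+ 3))).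

Lemma first_variation_eq0 m d x y a b : 0 < d ->
  admissible m x y -> admissible m a b ->
  (forall x' y', admissible m x' y' -> action m d x y <= action m d x' y') ->
  first_variation m d x y a b = 0.
Proof.
move=> d0 [ym xm] [bm am] minim.
pose q (x y a b : R) := (a ^+ 2 + b ^+ 2) * ((soft_norm d x y ^+ 2 * d)^-1 +
                                 (2 * soft_norm d x y ^+ 3)^-1).
pose B := \sum_(i < m)
  ((2 * (a i.+1 - a i) ^+ 2 + 4 * (b i.+1 - b i) ^+ 2) * m%:R
   + m%:R^-1 / 2 * (2 * (q (x i) (y i) (a i) (b i) + q (x i.+1) (y i.+1) (a i.+1) (b i.+1))
     + (q (y i) (y (m - i)%N) (b i) (b (m - i)%N) +
        q (y i.+1) (y (m - i.+1)%N) (b i.+1) (b (m - i.+1)%N)))).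
apply: (@stationary_of_quadratic_bound _ B) => s.
have := minim (fun i => x i + s * a i) (fun i => y i + s * b i).
have adm : admissible m (fun i => x i + s * a i) (fun i => y i + s * b i).
  split=> [|i im]; first by rewrite ym bm mulr0 addr0.
  by rewrite xm // am // mulrN opprD.
move=> /(_ adm) le1.
rewrite -(lerD2l (action m d x y)) addr0; apply: le_trans le1 _.
rewrite /action /xy_action /yz_action /first_variation /B !mulr_sumr -!big_split /=.
apply: ler_sum => i _.
have T1 := inv_soft_norm_taylor (x i) (y i) (a i) (b i) s d0.
have T2 := inv_soft_norm_taylor (x i.+1) (y i.+1) (a i.+1) (b i.+1) s d0.
have T3 := inv_soft_norm_taylor (y i) (y (m - i)%N) (b i) (b (m - i)%N) s d0.
have T4 := inv_soft_norm_taylor (y i.+1) (y (m - i.+1)%N) (b i.+1) (b (m - i.+1)%N) s d0.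
have h0 : 0 <= m%:R^-1 / 2 :> R by rewrite divr_ge0.
have {T1 T2}T := ler_wpM2l h0 (lerD T1 T2).
have {T3 T4}T' := ler_wpM2l h0 (lerD T3 T4).
move: T T'; rewrite -/(q _ _ _ _) -/(q _ _ _ _) -/(q _ _ _ _) -/(q _ _ _ _).
rewrite /rho /rho_yz.
set N := m%:R^-1; set M := m%:R.
set p1 := soft_norm d (x i + _) _; set p2 := soft_norm d (x i.+1 + _) _.
set p3 := soft_norm d (y i + _) _; set p4 := soft_norm d (y i.+1 + _) _.
set r1 := soft_norm d (x i) _; set r2 := soft_norm d (x i.+1) _.
set r3 := soft_norm d (y i) _; set r4 := soft_norm d (y i.+1) _.
set q1 := q _ _ _ _; set q2 := q _ _ _ _; set q3 := q _ _ _ _; set q4 := q _ _ _ _.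
move: q1 q2 q3 q4 => q1 q2 q3 q4.
set s1 := _ / r1 ^+ 3; set s2 := _ / r2 ^+ 3.
set s3 := _ / r3 ^+ 3; set s4 := _ / r4 ^+ 3.
move: s1 s2 s3 s4 (p1^-1) (p2^-1) (p3^-1) (p4^-1) (r1^-1) (r2^-1) (r3^-1) (r4^-1).
clear; move=> *; lra.
Qed.

Lemma sum_delta (f : nat -> R) m j :
  \sum_(i < m) f i * (i == j :> nat)%:R = f j * (j < m)%:R.
Proof.
elim: m => [|m IH]; first by rewrite big_ord0 ltn0 mulr0.
rewrite big_ord_recr /= IH ltnS [in RHS]leq_eqVlt eq_sym.
have [->|] := eqVneq j m; first by rewrite ltnn mulr0 add0r.
by rewrite mulr0 addr0.
Qed.

Lemma sum_deltaS (f : nat -> R) m j : (j <= m)%N ->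
  \sum_(i < m) f i * (i.+1 == j :> nat)%:R = f j.-1 * (0 < j)%:R.
Proof.
case: j => [|j] jm; first by rewrite big1 ?mulr0 // => i _; rewrite mulr0.
under eq_bigr do rewrite eqSS.
by rewrite (sum_delta (fun i => f i)) jm.
Qed.

Lemma sum_delta_form (k : R) (u c : nat -> R) m j : (j <= m)%N ->
  \sum_(i < m) (k * ((u i.+1 - u i) * ((i.+1 == j :> nat)%:R - (i == j :> nat)%:R))
    + (c i * (i == j :> nat)%:R + c i.+1 * (i.+1 == j :> nat)%:R)) =
  (0 < j)%:R * (k * (u j - u j.-1) + c j) + (j < m)%:R * (c j - k * (u j.+1 - u j)).
Proof.
move=> jm.
rewrite (eq_bigr (fun i : 'I_m =>
  (k * (u i.+1 - u i) + c i.+1) * (i.+1 == j :> nat)%:R +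
  (c i - k * (u i.+1 - u i)) * (i == j :> nat)%:R)); last by move=> i _; ring.
rewrite big_split /= (sum_delta (fun i => c i - k * (u i.+1 - u i))).
rewrite (sum_deltaS (fun i => k * (u i.+1 - u i) + c i.+1)) //.
by case: j jm => [|j] jm /=; rewrite ?mulr0 ?mul0r ?mulr1 ?mul1r // [X in _ + X]mulrC.
Qed.

(** The derivatives of the potential, up to a constant factor: y enters through the
distances in the planes (x, y) and (y, z), and x through (x, y) and, at the
reflected time, again through (x, y), which is (x, z). *)
Definition y_force m d x y i : R :=
  y i * ((rho d x y i ^+ 3)^-1 + (rho_yz m d y i ^+ 3)^-1).
Definition x_force m d x y i : R :=
  x i * ((rho d x y i ^+ 3)^-1 + (rho d x y (m - i)%N ^+ 3)^-1).

Lemma rho_yz_sym m d y i : (i <= m)%N -> rho_yz m d y (m - i) = rho_yz m d y i.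
Proof. by move=> im; rewrite /rho_yz subKn // /soft_norm [X in X + _]addrC. Qed.

Lemma sum_trap_rev m (c : nat -> R) :
  \sum_(i < m) (c (m - i)%N + c (m - i.+1)%N) = \sum_(i < m) (c i + c i.+1).
Proof.
rewrite (reindex_inj rev_ord_inj) /=; apply: eq_bigr => i _.
by rewrite subnSK // !subKn ?(ltnW (ltn_ord i)) // addrC.
Qed.

(** The variation is a unit bump at j.  At j = 0 only one neighbour is present,
which will be the equation of the even extension. *)
Lemma euler_lagrange_y m d x y j : (0 < m)%N -> 0 < d -> admissible m x y ->
  (forall x' y', admissible m x' y' -> action m d x y <= action m d x' y') ->
  (j < m)%N ->
  (0 < j)%:R * (y j - y j.-1) - (y j.+1 - y j) =
  m%:R^-2 / 8 * ((0 < j)%:R + 1) * y_force m d x y j.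
Proof.
move=> m0 d0 adm minim jm; have M0 : m%:R != 0 :> R by rewrite pnatr_eq0 -lt0n.
have admb : admissible m (fun=> 0 : R) (fun i => (i == j :> nat)%:R).
  by split=> [|i _]; [rewrite gtn_eqF|rewrite oppr0].
have := first_variation_eq0 d0 adm admb minim.
rewrite /first_variation.
pose b i : R := (i == j :> nat)%:R.
pose e i := y i * b i / rho_yz m d y i ^+ 3.
rewrite (eq_bigr (fun i : 'I_m =>
  (8 * m%:R * ((y i.+1 - y i) * (b i.+1 - b i)) +
   (- m%:R^-1 * (y i / rho d x y i ^+ 3) * b i +
    - m%:R^-1 * (y i.+1 / rho d x y i.+1 ^+ 3) * b i.+1))
   - m%:R^-1 / 2 * ((e i + e i.+1) + (e (m - i)%N + e (m - i.+1)%N)))); last first.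
  move=> i _; rewrite /e /b !rho_yz_sym // 1?ltnW //.
  by move: (rho _ _ _ _ ^+ 3) (rho _ _ _ _ ^+ 3) (rho_yz _ _ _ _ ^+ 3) => *; lra.
rewrite sumrB -[X in _ - X]mulr_sumr [X in _ - _ * X]big_split /= sum_trap_rev.
rewrite mulrDr -mulrDl -splitr mulr_sumr -sumrB.
rewrite (eq_bigr (fun i : 'I_m =>
  (8 * m%:R * ((y i.+1 - y i) * (b i.+1 - b i)) +
   (- m%:R^-1 * y_force m d x y i * b i +
    - m%:R^-1 * y_force m d x y i.+1 * b i.+1)))); last first.
  by move=> i _; rewrite /e /y_force; ring.
rewrite (sum_delta_form _ _ (fun i => - m%:R^-1 * y_force m d x y i)) ?(ltnW jm) //.
rewrite jm /=; set p := (0 < j)%:R; set Y := y_force _ _ _ _ _ => H.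
have {}H : 8 * m%:R * (p * (y j - y j.-1) - (y j.+1 - y j)) = m%:R^-1 * (p + 1) * Y.
  by lra.
have m8 : 8 * m%:R != 0 :> R by rewrite mulf_neq0 // pnatr_eq0.
apply: (mulfI m8); rewrite H; field; exact: M0.
Qed.

(** The variation must stay odd about 1/2: it is a bump at j minus a bump at the
reflected index, and the two contributions coincide because x is odd. *)
Lemma euler_lagrange_x m d x y j : (0 < m)%N -> 0 < d -> admissible m x y ->
  (forall x' y', admissible m x' y' -> action m d x y <= action m d x' y') ->
  (j < m)%N ->
  (0 < j)%:R * (x j - x j.-1) - (x j.+1 - x j) =
  m%:R^-2 / 8 * ((0 < j)%:R + 1) * x_force m d x y j.
Proof.
move=> m0 d0 adm minim jm; have M0 : m%:R != 0 :> R by rewrite pnatr_eq0 -lt0n.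
pose a k i : R := (i == k :> nat)%:R.
have adma : admissible m (fun i => a j i - a (m - j)%N i) (fun=> 0 : R).
  split=> // i im; rewrite opprB /a.
  have -> : (m - i == j)%N = (i == m - j)%N by apply/eqP/eqP; lia.
  by have -> : (m - i == m - j)%N = (i == j)%N by apply/eqP/eqP; lia.
have := first_variation_eq0 d0 adm adma minim.
rewrite /first_variation.
pose c i := - m%:R^-1 * (x i / rho d x y i ^+ 3).
pose T k i := 4 * m%:R * ((x i.+1 - x i) * (a k i.+1 - a k i)) +
   (c i * a k i + c i.+1 * a k i.+1).
rewrite (eq_bigr (fun i : 'I_m => T j i - T (m - j)%N i)); last first.
  move=> i _; rewrite /T /c !mulr0 !addr0 !mul0r.
  by move: (rho _ _ _ _ ^+ 3) (rho _ _ _ _ ^+ 3) => *; lra.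
rewrite sumrB /T (sum_delta_form _ _ c) ?(ltnW jm) //.
rewrite (sum_delta_form _ _ c) ?leq_subr // jm.
have -> : (0 < m - j)%N by rewrite subn_gt0.
have -> : (m - j < m)%N = (0 < j)%N by lia.
have [_ xm] := adm.
have e1 : x (m - j)%N = - x j by apply: xm; exact: ltnW.
have e2 : x (m - j).-1 = - x j.+1 by rewrite -subnS; exact: xm.
have e3 : (0 < j)%:R * x (m - j).+1 = - ((0 < j)%:R * x j.-1).
  case: (j) jm => [|k] jm; rewrite ?mul0r ?oppr0 //= !mul1r.
  by rewrite subnSK ?(ltnW jm) //; apply: xm; lia.
have e4 : c (m - j)%N = m%:R^-1 * (x j / rho d x y (m - j)%N ^+ 3).
  by rewrite /c e1; ring.
set p : R := (0 < j)%:R in e3 *.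
have -> : p * (c (m - j)%N - 4 * m%:R * (x (m - j).+1 - x (m - j)%N)) =
   p * c (m - j)%N - 4 * m%:R * (p * x (m - j).+1 - p * x (m - j)%N) by ring.
rewrite e3 e2 e1 e4 /c /= => H.
have {}H : 8 * m%:R * (p * (x j - x j.-1) - (x j.+1 - x j)) =
    m%:R^-1 * (p + 1) * x_force m d x y j.
  rewrite /x_force; move: H.
  move: (rho _ _ _ _ ^+ 3) (rho _ _ _ _ ^+ 3) => *; lra.
have m8 : 8 * m%:R != 0 :> R by rewrite mulf_neq0 // pnatr_eq0.
apply: (mulfI m8); rewrite H; field; exact: M0.
Qed.
End EulerLagrange.

(** * Reflection to the whole line *)

Section Extension.
Context (R : realType).

Lemma int_reflection_ind (m : nat) (P : int -> Prop) : (0 < m)%N ->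
  (forall i, P i -> P (- i)) -> (forall i, P i -> P (m.*2%:Z - i)) ->
  (forall i : nat, (i <= m)%N -> P i%:Z) -> forall i, P i.
Proof.
move=> m0 PN PB Pm.
have base (r : nat) : (r < m.*2)%N -> P r%:Z.
  move=> rm; have [/Pm//|mr] := leqP r m.
  have -> : r%:Z = m.*2%:Z - (m.*2 - r)%N%:Z by lia.
  by apply: PB; apply: Pm; lia.
have shift (k : nat) i : P i -> P (i + k%:Z * m.*2%:Z).
  elim: k i => [|k IH] i Pi; first by rewrite mul0r addr0.
  have -> : i + k.+1%:Z * m.*2%:Z = m.*2%:Z - (- (i + k%:Z * m.*2%:Z)) by lia.
  by apply: PB; apply: PN; exact: IH.
have pos (k : nat) : P k%:Z.
  have := divn_eq k m.*2; set q := (k %/ _)%N; set r := (k %% _)%N => ->.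
  rewrite PoszD PoszM addrC; apply: shift; apply: base.
  by rewrite ltn_mod double_gt0.
by case=> k; [exact: pos|rewrite NegzE; apply: PN; exact: pos].
Qed.

(** When b (p - r) = - b r on [0, p], this is the extension that is even about 0
and odd about p / 2; x is of this kind with p = m, and y, continued to [0, 2m] as an
odd function about m, with p = 2m. *)
Definition antiperiodic_ext (p : nat) (b : nat -> R) (i : int) : R :=
  let r := absz (i %% (p.*2%:Z))%Z in if (r < p)%N then b r else - b (r - p)%N.

Lemma antiperiodic_ext_val p b (q : int) (r : nat) : (r < p.*2)%N ->
  antiperiodic_ext p b (q * p.*2%:Z + r%:Z) =
  if (r < p)%N then b r else - b (r - p)%N.
Proof.
move=> rp; rewrite /antiperiodic_ext.
have -> : ((q * p.*2%:Z + r%:Z) %% p.*2%:Z)%Z = r%:Z.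
  by rewrite modzMDl modz_small // lez_nat ltz_nat rp.
by [].
Qed.

Lemma antiperiodic_ext_nat p b (r : nat) : (0 < p)%N -> b p = - b 0%N ->
  (r <= p)%N -> antiperiodic_ext p b r%:Z = b r.
Proof.
move=> p0 bp rp; have := @antiperiodic_ext_val p b 0 r.
rewrite mul0r add0r => -> //; last by lia.
case: ltnP => // pr; have -> : r = p by lia.
by rewrite subnn bp.
Qed.

Lemma antiperiodic_ext_sym p b : (0 < p)%N ->
  (forall r, (r <= p)%N -> b (p - r)%N = - b r) -> forall i,
  antiperiodic_ext p b (- i) = antiperiodic_ext p b i /\
  antiperiodic_ext p b (p%:Z - i) = - antiperiodic_ext p b i.
Proof.
move=> p0 bp i.
have P0 : 0 < p.*2%:Z :> int by lia.
have [q [r [rp ->]]] : exists (q : int) (r : nat), (r < p.*2)%N /\ i = q * p.*2%:Z + r%:Z.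
  exists (i %/ p.*2%:Z)%Z, (absz (i %% p.*2%:Z)%Z); split.
    have := ltz_pmod i P0; have := modz_ge0 i (lt0r_neq0 P0); lia.
  rewrite gez0_abs ?modz_ge0 ?lt0r_neq0 //; exact: divz_eq.
rewrite (antiperiodic_ext_val b q rp).
have b00 : b p = - b 0%N by rewrite -[p in b p]subn0 bp.
split.
  have [r0|r0] := posnP r.
    subst r; have -> : - (q * p.*2%:Z + 0%N%:Z) = - q * p.*2%:Z + 0%N%:Z by ring.
    by rewrite (antiperiodic_ext_val b _ rp).
  have -> : - (q * p.*2%:Z + r%:Z) = (- q - 1) * p.*2%:Z + (p.*2 - r)%N%:Z by lia.
  rewrite antiperiodic_ext_val; last by lia.
  case: (ltnP r p) => rp'.
    have -> : (p.*2 - r < p)%N = false by lia.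
    have -> : (p.*2 - r - p = p - r)%N by lia.
    by rewrite bp ?opprK // ltnW.
  have [e|ne] := eqVneq r p.
    subst r; have -> : (p.*2 - p < p)%N = false by lia.
    by have -> : (p.*2 - p - p = p - p)%N by lia.
  have -> : (p.*2 - r < p)%N by lia.
  have -> : (p.*2 - r = p - (r - p))%N by lia.
  by rewrite bp //; lia.
have [rp'|rp'] := leqP r p.
  have -> : p%:Z - (q * p.*2%:Z + r%:Z) = - q * p.*2%:Z + (p - r)%N%:Z by lia.
  rewrite antiperiodic_ext_val; last by lia.
  have [r0|r0] := posnP r.
    by subst r; rewrite subn0 ltnn p0 subnn.
  have -> : (p - r < p)%N by lia.
  case: (ltnP r p) => rp''; first by rewrite bp.
  have -> : r = p by lia.
  by rewrite subnn opprK.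
have -> : p%:Z - (q * p.*2%:Z + r%:Z) = (- q - 1) * p.*2%:Z + (p.*2 + p - r)%N%:Z by lia.
rewrite antiperiodic_ext_val; last by lia.
have -> : (p.*2 + p - r < p)%N = false by lia.
have -> : (r < p)%N = false by lia.
have -> : (p.*2 + p - r - p = p - (r - p))%N by lia.
by rewrite bp ?opprK //; lia.
Qed.

Lemma soft_norm_absl d (a b a' b' : R) : `|a| = `|a'| -> `|b| = `|b'| ->
  soft_norm d a b = soft_norm d a' b'.
Proof.
by move=> aa bb; rewrite /soft_norm -(real_normK (num_real a)) aa real_normK
  ?num_real // -(real_normK (num_real b)) bb real_normK ?num_real.
Qed.

Definition xy_dist d (X Y : int -> R) i : R := soft_norm d (X i) (Y i).
Definition yz_dist (m : nat) d (Y : int -> R) i : R := soft_norm d (Y i) (Y (m%:Z - i)).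

Definition accel_x (m : nat) d (X Y : int -> R) i : R :=
  - (X i / 4 * ((xy_dist d X Y i ^+ 3)^-1 + (xy_dist d X Y (m%:Z - i) ^+ 3)^-1)).
Definition accel_y (m : nat) d (X Y : int -> R) i : R :=
  - (Y i / 4 * ((xy_dist d X Y i ^+ 3)^-1 + (yz_dist m d Y i ^+ 3)^-1)).

(** The bounds do not depend on m and d; this is what survives in the limit. *)
Record discrete_solution (m : nat) (d : R) (X Y : int -> R) : Prop := {
  ds_xN : forall i, X (- i) = X i;
  ds_xB : forall i, X (m%:Z - i) = - X i;
  ds_yN : forall i, Y (- i) = Y i;
  ds_yB : forall i, Y (m.*2%:Z - i) = - Y i;
  ds_bound : forall i, `|X i| <= 3 /\ `|Y i| <= 3;
  ds_dist : forall i, 1 / 1000 ^+ 2 <= xy_dist d X Y i /\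
                      1 / 1000 ^+ 2 <= yz_dist m d Y i;
  ds_x : forall i, X (i + 1) - X i = X i - X (i - 1) + m%:R^-2 * accel_x m d X Y i;
  ds_y : forall i, Y (i + 1) - Y i = Y i - Y (i - 1) + m%:R^-2 * accel_y m d X Y i
}.

Lemma abs_le3 (a : R) : a ^+ 2 <= 9 -> `|a| <= 3.
Proof.
move=> a9; rewrite -(@ler_pXn2r _ 2) ?nnegrE // real_normK ?num_real //; lra.
Qed.

(** Everything to be checked is invariant under the reflections about 0 and
about m, whose translates of [0, m] cover the integers; so only [0, m] matters,
where the Euler-Lagrange equations hold. *)
Lemma exists_discrete_solution n d : (600 <= n)%N -> 0 < d -> d <= 1 / 100 ->
  exists X Y, discrete_solution n.*2 d X Y.
Proof.
move=> n600 d0 d1; have n0 : (0 < n)%N by apply: leq_trans n600.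
set m := n.*2; have m0 : (0 < m)%N by rewrite double_gt0.
have M0 : 0 < m%:R :> R by rewrite ltr0n.
have [x [y [adm minim]]] := exists_minimiser m0 d0.
have act : action m d x y <= 237 / 25.
  apply: le_trans (minim _ _ (test_admissible R m0)) _.
  by apply: test_action => //; rewrite /m; lia.
have [ym xm] := adm.
have ener : energy m x <= 9 /\ energy m y <= 9.
  have pot_ge0 (r : nat -> R) : (forall i, 0 < r i) ->
      0 <= \sum_(i < m) (m%:R^-1 / 2 * ((r i)^-1 + (r i.+1)^-1)).
    move=> r0; rewrite sumr_ge0 // => i _.
    by rewrite mulr_ge0 ?divr_ge0 ?addr_ge0 ?invr_ge0 ?ltW.
  move: act; rewrite /action xy_action_split // yz_action_split //.
  have := energy_ge0 m x; have := energy_ge0 m y.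
  have := pot_ge0 _ (fun i => soft_norm_gt0 (x i) (y i) d0).
  have := pot_ge0 _ (fun i => soft_norm_gt0 (y i) (y (m - i)%N) d0).
  rewrite /rho_yz /rho; split; lra.
have bound_x i : (i <= m)%N -> `|x i| <= 3.
  move=> im; apply: abs_le3; have := admissible_x_bound adm im.
  by have := sqr_ge0 (x i); have [] := ener; lra.
have bound_y i : (i <= m)%N -> `|y i| <= 3.
  move=> im; apply: abs_le3; have := admissible_y_bound adm im.
  rewrite -ler_pdivlMr // => H; apply: le_trans H _; rewrite ler_pdivrMr //.
  have := ler_wpM2r (energy_ge0 m y) (_ : m%:R - i%:R <= m%:R :> R).
  rewrite gerBl ler0n => /(_ isT) H; apply: le_trans H _.
  by rewrite mulrC ler_wpM2r //; have [] := ener.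
pose yy (r : nat) : R := if (r <= m)%N then y r else - y (m.*2 - r)%N.
have yyP r : (r <= m.*2)%N -> yy (m.*2 - r)%N = - yy r.
  move=> rm; rewrite /yy; case: (ltngtP r m) => h.
  - by rewrite subKn //; case: leqP => //; lia.
  - by rewrite opprK; case: leqP => //; lia.
  - by rewrite h -addnn addnK leqnn ym oppr0.
pose X := antiperiodic_ext m x; pose Y := antiperiodic_ext m.*2 yy.
have mm0 : (0 < m.*2)%N by rewrite double_gt0.
have XE (i : nat) : (i <= m)%N -> X i%:Z = x i.
  by move=> im; apply: antiperiodic_ext_nat => //; rewrite -[m in x m]subn0 xm.
have YE (i : nat) : (i <= m)%N -> Y i%:Z = y i.
  move=> im; rewrite /Y antiperiodic_ext_nat //; last by lia.
    by rewrite /yy im.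
  by rewrite -{1}[m.*2]subn0 yyP.
have XN i : X (- i) = X i by case: (antiperiodic_ext_sym m0 xm i).
have XB i : X (m%:Z - i) = - X i by case: (antiperiodic_ext_sym m0 xm i).
have YN i : Y (- i) = Y i by case: (antiperiodic_ext_sym mm0 yyP i).
have YB i : Y (m.*2%:Z - i) = - Y i by case: (antiperiodic_ext_sym mm0 yyP i).
have X2 i : X (m.*2%:Z - i) = X i.
  have -> : m.*2%:Z - i = m%:Z - - (m%:Z - i) by lia.
  by rewrite XB XN XB opprK.
have XD i : `|X (m%:Z + i)| = `|X i|.
  by rewrite -{1}[i]opprK XB normrN XN.
have YD i : Y (m%:Z + i) = - Y (m%:Z - i).
  by have -> : m%:Z + i = m.*2%:Z - (m%:Z - i) by lia; rewrite YB.
have rN i : xy_dist d X Y (- i) = xy_dist d X Y i by rewrite /xy_dist XN YN.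
have rB i : xy_dist d X Y (m.*2%:Z - i) = xy_dist d X Y i.
  by apply: soft_norm_absl; rewrite ?X2 ?YB ?normrN.
have rD i : xy_dist d X Y (m%:Z + i) = xy_dist d X Y (m%:Z - i).
  by have -> : m%:Z + i = m.*2%:Z - (m%:Z - i) by lia; rewrite rB.
have sN i : yz_dist m d Y (- i) = yz_dist m d Y i.
  by rewrite /yz_dist YN opprK YD; apply: soft_norm_absl => //; rewrite normrN.
have sB i : yz_dist m d Y (m.*2%:Z - i) = yz_dist m d Y i.
  have e : m%:Z - (m.*2%:Z - i) = - (m%:Z - i) by lia.
  by rewrite /yz_dist YB e YN; apply: soft_norm_absl => //; rewrite normrN.
have rE (i : nat) : (i <= m)%N -> xy_dist d X Y i%:Z = rho d x y i.
  by move=> im; rewrite /xy_dist XE // YE.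
have sE (i : nat) : (i <= m)%N -> yz_dist m d Y i%:Z = rho_yz m d y i.
  move=> im; rewrite /yz_dist YE //; have -> : m%:Z - i%:Z = (m - i)%N%:Z by lia.
  by rewrite YE // leq_subr.
exists X, Y; split=> //.
- apply: (int_reflection_ind m0) => i; first by rewrite XN YN.
    by rewrite X2 YB normrN.
  by move=> im; rewrite XE // YE //; split; [exact: bound_x|exact: bound_y].
- apply: (int_reflection_ind m0) => i; first by rewrite rN sN.
    by rewrite rB sB.
  by move=> im; rewrite rE // sE //; exact: no_near_collision n0 d0 d1 adm act im.
- have AN i : accel_x m d X Y (- i) = accel_x m d X Y i.
    by rewrite /accel_x XN rN opprK rD.
  have AB i : accel_x m d X Y (m%:Z - i) = - accel_x m d X Y i.
    rewrite /accel_x XB; have -> : m%:Z - (m%:Z - i) = i by lia.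
    by rewrite [in LHS]addrC; ring.
  have PN i : X (i + 1) - X i = X i - X (i - 1) + m%:R^-2 * accel_x m d X Y i ->
      X (- i + 1) - X (- i) = X (- i) - X (- i - 1) + m%:R^-2 * accel_x m d X Y (- i).
    have -> : - i + 1 = - (i - 1) by lia.
    have -> : - i - 1 = - (i + 1) by lia.
    by rewrite AN !XN => H; lra.
  have PB i : X (i + 1) - X i = X i - X (i - 1) + m%:R^-2 * accel_x m d X Y i ->
      X (m%:Z - i + 1) - X (m%:Z - i) =
      X (m%:Z - i) - X (m%:Z - i - 1) + m%:R^-2 * accel_x m d X Y (m%:Z - i).
    have -> : m%:Z - i + 1 = m%:Z - (i - 1) by lia.
    have -> : m%:Z - i - 1 = m%:Z - (i + 1) by lia.
    by rewrite AB !XB => H; lra.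
  have low (i : nat) : (i < m)%N -> X (i%:Z + 1) - X i%:Z =
      X i%:Z - X (i%:Z - 1) + m%:R^-2 * accel_x m d X Y i%:Z.
    move=> im; have := euler_lagrange_x m0 d0 adm minim im.
    have eA : accel_x m d X Y i%:Z = - (x_force m d x y i / 4).
      rewrite /accel_x XE 1?ltnW // rE 1?ltnW //.
      have -> : m%:Z - i%:Z = (m - i)%N%:Z by lia.
      by rewrite rE ?leq_subr // /x_force; ring.
    have -> : i%:Z + 1 = i.+1%:Z by lia.
    rewrite eA (XE i) ?(ltnW im) // (XE i.+1) //; case: i im {eA} => [|i] im.
      have -> : X (0%N%:Z - 1) = X 1%N%:Z by rewrite -[RHS]XN.
      by rewrite (XE 1%N) //= mul0r add0r mulr0n add0r; lra.
    have -> : i.+1%:Z - 1 = i%:Z by lia.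
    by rewrite (XE i) ?(ltnW (ltnW im)) //= mul1r; lra.
  apply: (int_reflection_ind m0) => // [i Pi|i].
    have -> : m.*2%:Z - i = m%:Z - - (m%:Z - i) by lia.
    by apply: (PB); apply: PN; exact: PB.
  rewrite leq_eqVlt => /orP[/eqP ->|]; last exact: low.
  have -> : m%:Z = m%:Z - 0%N%:Z by lia.
  by apply: PB; exact: low.
- have AN i : accel_y m d X Y (- i) = accel_y m d X Y i.
    by rewrite /accel_y YN rN sN.
  have AB i : accel_y m d X Y (m.*2%:Z - i) = - accel_y m d X Y i.
    by rewrite /accel_y YB rB sB; ring.
  have PN i : Y (i + 1) - Y i = Y i - Y (i - 1) + m%:R^-2 * accel_y m d X Y i ->
      Y (- i + 1) - Y (- i) = Y (- i) - Y (- i - 1) + m%:R^-2 * accel_y m d X Y (- i).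
    have -> : - i + 1 = - (i - 1) by lia.
    have -> : - i - 1 = - (i + 1) by lia.
    by rewrite AN !YN => H; lra.
  have PB i : Y (i + 1) - Y i = Y i - Y (i - 1) + m%:R^-2 * accel_y m d X Y i ->
      Y (m.*2%:Z - i + 1) - Y (m.*2%:Z - i) =
      Y (m.*2%:Z - i) - Y (m.*2%:Z - i - 1) + m%:R^-2 * accel_y m d X Y (m.*2%:Z - i).
    have -> : m.*2%:Z - i + 1 = m.*2%:Z - (i - 1) by lia.
    have -> : m.*2%:Z - i - 1 = m.*2%:Z - (i + 1) by lia.
    by rewrite AB !YB => H; lra.
  apply: (int_reflection_ind m0) => // i.
  rewrite leq_eqVlt => /orP[/eqP ->|im].
    have -> : m%:Z - 1 = m.*2%:Z - (m%:Z + 1) by lia.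
    have Ym0 : Y m%:Z = 0 by rewrite YE.
    by rewrite YB /accel_y Ym0 mul0r mul0r oppr0 mulr0; lra.
  have := euler_lagrange_y m0 d0 adm minim im.
  have eA : accel_y m d X Y i%:Z = - (y_force m d x y i / 4).
    by rewrite /accel_y YE 1?ltnW // rE 1?ltnW // sE 1?ltnW // /y_force; ring.
  have -> : i%:Z + 1 = i.+1%:Z by lia.
  rewrite eA (YE i) ?(ltnW im) // (YE i.+1) //; case: i im {eA} => [|i] im.
    have -> : Y (0%N%:Z - 1) = Y 1%N%:Z by rewrite -[RHS]YN.
    by rewrite (YE 1%N) //= mul0r add0r mulr0n add0r; lra.
  have -> : i.+1%:Z - 1 = i%:Z by lia.
  by rewrite (YE i) ?(ltnW (ltnW im)) //= mul1r; lra.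
Qed.
End Extension.

(** * Bounds independent of the mesh *)

Section DiscreteRegularity.
Context (R : realType).
Implicit Types (f g : int -> R) (h B : R).

(** A bound for a grid function and for its difference quotients by one constant,
which makes the class stable under sums, products and, away from 0, inverses. *)
Definition lip h B f := forall i, `|f i| <= B /\ `|f (i + 1) - f i| <= h * B.

Lemma lip_ge0 h B f : lip h B f -> 0 <= B.
Proof. by move=> /(_ 0) [H _]; apply: le_trans H. Qed.

Lemma lip_widen h B B' f : 0 <= h -> B <= B' -> lip h B f -> lip h B' f.
Proof.
move=> h0 BB lf i; have [f1 f2] := lf i; split; first exact: le_trans BB.
by apply: le_trans f2 _; exact: ler_wpM2l.
Qed.

Lemma lipM h B B' f g : lip h B f -> lip h B' g ->
  lip h (2 * (B * B')) (fun i => f i * g i).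
Proof.
move=> lf lg i; have [f1 f2] := lf i; have [g1 g2] := lg i.
have [f3 _] := lf (i + 1).
have B0 := lip_ge0 lf; have B0' := lip_ge0 lg; split.
  rewrite normrM; have := ler_pM (normr_ge0 _) (normr_ge0 _) f1 g1.
  by have := mulr_ge0 B0 B0'; lra.
have -> : f (i + 1) * g (i + 1) - f i * g i =
  f (i + 1) * (g (i + 1) - g i) + (f (i + 1) - f i) * g i by ring.
apply: le_trans (ler_normD _ _) _; rewrite !normrM.
have := ler_pM (normr_ge0 _) (normr_ge0 _) f3 g2.
by have := ler_pM (normr_ge0 _) (normr_ge0 _) f2 g1; lra.
Qed.

Lemma lipD h B B' f g : lip h B f -> lip h B' g -> lip h (B + B') (fun i => f i + g i).
Proof.
move=> lf lg i; have [f1 f2] := lf i; have [g1 g2] := lg i; split.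
  by apply: le_trans (ler_normD _ _) _; exact: lerD.
rewrite opprD addrACA mulrDr.
by apply: le_trans (ler_normD _ _) _; exact: lerD.
Qed.

Lemma lip_scale h B f (k : R) : `|k| <= 1 -> lip h B f -> lip h B (fun i => k * f i).
Proof.
move=> k1 lf i; have [f1 f2] := lf i; split.
  by rewrite normrM; apply: le_trans f1; exact: ler_piMl.
by rewrite -mulrBr normrM; apply: le_trans f2; exact: ler_piMl.
Qed.

Lemma lip_reflect h B f (m : int) : lip h B f -> lip h B (fun i => f (m - i)).
Proof.
move=> lf i; split; first by have [] := lf (m - i).
have [_] := lf (m - (i + 1)); rewrite distrC.
by have -> : m - (i + 1) + 1 = m - i by ring.
Qed.

Lemma lipV h B c f : 0 <= h -> 0 <= B -> 0 < c -> (forall i, c <= f i) ->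
  (forall i, `|f (i + 1) - f i| <= h * B) ->
  lip h (c^-1 + B * c^-1 ^+ 2) (fun i => (f i)^-1).
Proof.
move=> h0 B0 c0 cf lf i; have f0 j : 0 < f j by apply: lt_le_trans (cf j).
have inv j : `|(f j)^-1| <= c^-1.
  by rewrite ger0_norm ?invr_ge0 ?(ltW (f0 j)) // lef_pV2 ?posrE.
have c1 : 0 < c^-1 by rewrite invr_gt0.
split; first by apply: le_trans (inv i) _; rewrite lerDl mulr_ge0 ?sqr_ge0.
have -> : (f (i + 1))^-1 - (f i)^-1 =
    - (f (i + 1) - f i) * ((f (i + 1))^-1 * (f i)^-1).
  by field; rewrite !gt_eqF.
rewrite !normrM normrN.
have := ler_pM (normr_ge0 _) (normr_ge0 _) (inv (i + 1)) (inv i).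
move=> /(ler_pM (normr_ge0 _) (mulr_ge0 (normr_ge0 _) (normr_ge0 _)) (lf i)).
move=> H; apply: le_trans H _.
have := mulr_ge0 h0 (ltW c1); lra.
Qed.

Lemma soft_norm_lip_seq h B d f g : 0 <= h -> lip h B f -> lip h B g -> forall i,
  `|soft_norm d (f (i + 1)) (g (i + 1)) - soft_norm d (f i) (g i)| <= h * (2 * B).
Proof.
move=> h0 lf lg i; have [_ f2] := lf i; have [_ g2] := lg i.
have hB : 0 <= h * B by exact: mulr_ge0 (lip_ge0 lf).
have hB2 : 0 <= h * (2 * B) by lra.
rewrite -(@ler_pXn2r _ 2) ?nnegrE // real_normK ?num_real //.
apply: le_trans (soft_norm_lip _ _ _ _ _) _.
have sq (u : R) : `|u| <= h * B -> u ^+ 2 <= (h * B) ^+ 2.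
  by move=> H; rewrite -(real_normK (num_real u)) ler_pXn2r ?nnegrE.
have := sq _ f2; have := sq _ g2; have := sqr_ge0 (h * B); lra.
Qed.

Lemma lip_inv_cube h B c f : 0 <= h -> 0 <= B -> 0 < c -> (forall i, c <= f i) ->
  (forall i, `|f (i + 1) - f i| <= h * B) ->
  lip h (4 * (c^-1 + B * c^-1 ^+ 2) ^+ 3) (fun i => (f i ^+ 3)^-1).
Proof.
move=> h0 B0 c0 cf lf; have L := lipV h0 B0 c0 cf lf.
have := lipM L (lipM L L); set K := c^-1 + _.
have -> : 2 * (K * (2 * (K * K))) = 4 * K ^+ 3 by ring.
move=> H i; have := H i; rewrite !exprS expr0 !mulr1 !invfM.
by [].
Qed.

Definition velocity (m : nat) f (i : int) : R := (f (i + 1) - f i) * m%:R.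

(** Evenness makes the velocity at 0 small; its variation over one period is
controlled by the acceleration. *)
Lemma velocity_bound (m : nat) f (K : R) : (0 < m)%N -> 0 <= K ->
  (forall i, f (- i) = f i) -> (forall i, f (i + 1) - f i = f (i + (4 * m)%N%:Z + 1) - f (i + (4 * m)%N%:Z)) ->
  (forall i, `|velocity m f (i + 1) - velocity m f i| <= m%:R^-1 * K) ->
  forall i, `|velocity m f i| <= 5 * K.
Proof.
move=> m0 K0 fN fp vK; have M0 : 0 < m%:R :> R by rewrite ltr0n.
have v0 : `|velocity m f 0| <= K.
  have := vK (- 1); rewrite /velocity addNr add0r fN.
  have -> : (f 1 - f 0) * m%:R - (f 0 - f 1) * m%:R = 2 * ((f 1 - f 0) * m%:R) by ring.
  rewrite normrM ger0_norm // => H.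
  have : m%:R^-1 * K <= K by rewrite ler_piMl // invf_le1 // ler1n.
  by have := normr_ge0 ((f 1 - f 0) * m%:R : R); lra.
have vn (n : nat) : `|velocity m f n%:Z| <= K + n%:R * (m%:R^-1 * K).
  elim: n => [|n IH]; first by rewrite mul0r addr0.
  have := vK n%:Z; have -> : n%:Z + 1 = n.+1%:Z by lia.
  rewrite -natr1 => H.
  have := ler_normD (velocity m f n.+1%:Z - velocity m f n%:Z) (velocity m f n%:Z).
  by rewrite subrK; lra.
have vp i : velocity m f (i + (4 * m)%N%:Z) = velocity m f i.
  by rewrite /velocity (fp i).
have vpn (k : nat) i : velocity m f (i + k%:Z * (4 * m)%N%:Z) = velocity m f i.
  elim: k => [|k IH]; first by rewrite mul0r addr0.
  by rewrite -IH -[RHS]vp; congr (velocity m f _); lia.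
have vpz (k : int) i : velocity m f (k * (4 * m)%N%:Z + i) = velocity m f i.
  case: k => k; first by rewrite addrC vpn.
  rewrite NegzE -[LHS](vpn k.+1); congr (velocity m f _); lia.
move=> i; rewrite (divz_eq i (4 * m)%N%:Z) vpz.
have P0 : 0 < (4 * m)%N%:Z :> int by lia.
set r := (i %% _)%Z.
have r0 : 0 <= r by rewrite modz_ge0 // lt0r_neq0.
have rP : r < (4 * m)%N%:Z by exact: ltz_pmod.
rewrite -(gez0_abs r0); apply: le_trans (vn _) _.
have : (absz r)%:R <= 4 * m%:R :> R.
  by rewrite -natrM ler_nat; lia.
move=> /(ler_wpM2r (_ : 0 <= m%:R^-1 * K)).
have -> : 4 * m%:R * (m%:R^-1 * K) = 4 * K by field; rewrite gt_eqF.
by rewrite mulr_ge0 ?invr_ge0 // => /(_ isT); lra.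
Qed.

Lemma discrete_solution_periodic (m : nat) (d : R) X Y : discrete_solution m d X Y ->
  (forall i, X (i + 1) - X i = X (i + (4 * m)%N%:Z + 1) - X (i + (4 * m)%N%:Z)) /\
  (forall i, Y (i + 1) - Y i = Y (i + (4 * m)%N%:Z + 1) - Y (i + (4 * m)%N%:Z)).
Proof.
move=> [xN xB yN yB _ _ _ _].
have e4 i : i + (4 * m)%N%:Z = m.*2%:Z - - (m.*2%:Z - - i) by lia.
have e2 i : i + (4 * m)%N%:Z = m%:Z - - (m%:Z - - (m%:Z - - (m%:Z - - i))) by lia.
have Xp i : X (i + (4 * m)%N%:Z) = X i by rewrite e2 !(xB, xN) !opprK.
have Yp i : Y (i + (4 * m)%N%:Z) = Y i by rewrite e4 !(yB, yN) !opprK.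
by split=> i; rewrite (addrAC i) ?Xp ?Yp.
Qed.

Record regular_solution (m : nat) (d D : R) (X Y : int -> R) : Prop := {
  rs_sol : discrete_solution m d X Y;
  rs_x : lip m%:R^-1 D X; rs_y : lip m%:R^-1 D Y;
  rs_vx : lip m%:R^-1 D (velocity m X); rs_vy : lip m%:R^-1 D (velocity m Y);
  rs_ax : lip m%:R^-1 D (accel_x m d X Y); rs_ay : lip m%:R^-1 D (accel_y m d X Y);
  rs_dvx : forall i, velocity m X (i + 1) - velocity m X i =
                     m%:R^-1 * accel_x m d X Y (i + 1);
  rs_dvy : forall i, velocity m Y (i + 1) - velocity m Y i =
                     m%:R^-1 * accel_y m d X Y (i + 1)
}.

Lemma discrete_solution_regular :
  exists D : R, forall m d X Y, (0 < m)%N -> 0 < d ->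
    discrete_solution m d X Y -> regular_solution m d D X Y.
Proof.
have [c c0 cE] : exists2 c : R, 0 < c & c = 1 / 1000 ^+ 2.
  by exists (1 / 1000 ^+ 2); first lra.
pose M := 2 * c^-1 ^+ 3; pose B := 3 + 5 * M.
pose K := 4 * (c^-1 + 2 * B * c^-1 ^+ 2) ^+ 3.
exists (B + M + 2 * (B * (K + K))) => m e X Y m0 e0 sol.
have M0 : 0 < m%:R :> R by rewrite ltr0n.
set h : R := m%:R^-1; have h0 : 0 <= h by rewrite invr_ge0.
have ci : 0 < c^-1 by rewrite invr_gt0.
have M_ge0 : 0 <= M by rewrite mulr_ge0 // exprn_ge0 // ltW.
have B0 : 0 <= B by rewrite /B; lra.
have K0 : 0 <= K by rewrite mulr_ge0 // exprn_ge0 // addr_ge0 ?mulr_ge0 ?sqr_ge0 // ltW.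
have BK : 0 <= B * (K + K) by rewrite mulr_ge0 // addr_ge0.
have cd i : c <= xy_dist e X Y i /\ c <= yz_dist m e Y i.
  by rewrite cE; exact: (ds_dist sol).
have inv3 (r : R) : c <= r -> 0 <= (r ^+ 3)^-1 <= c^-1 ^+ 3.
  move=> cr; have r0 : 0 < r by exact: lt_le_trans cr.
  rewrite invr_ge0 exprn_ge0 ?(ltW r0) //= -exprVn ler_pXn2r ?nnegrE ?invr_ge0 ?(ltW r0) ?(ltW c0) //.
  by rewrite lef_pV2 ?posrE.
have accb (z r s : R) : `|z| <= 3 -> c <= r -> c <= s ->
    `|- (z / 4 * ((r ^+ 3)^-1 + (s ^+ 3)^-1))| <= M.
  move=> z3 /inv3/andP[r0 r1] /inv3/andP[s0 s1].
  rewrite normrN normrM (ger0_norm (addr_ge0 r0 s0)) normrM (@ger0_norm _ 4^-1) //.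
  have z4 : `|z| / 4 <= 1 by lra.
  have := ler_pM (mulr_ge0 (normr_ge0 z) (_ : 0 <= 4^-1)) (addr_ge0 r0 s0) z4 (lerD r1 s1).
  by rewrite invr_ge0 ler0n => /(_ isT) H; apply: le_trans H _; rewrite /M; lra.
have axb i : `|accel_x m e X Y i| <= M.
  by apply: accb; [case: (ds_bound sol i)|case: (cd i)|case: (cd (m%:Z - i))].
have ayb i : `|accel_y m e X Y i| <= M.
  by apply: accb; [case: (ds_bound sol i)|case: (cd i)|case: (cd i)].
have dv f A : (forall i, f (i + 1) - f i = f i - f (i - 1) + m%:R^-2 * A i) ->
    forall i, velocity m f (i + 1) - velocity m f i = h * A (i + 1).
  move=> E i; rewrite /velocity E addrK /h.
  by field; rewrite gt_eqF.
have dvx := dv _ _ (ds_x sol); have dvy := dv _ _ (ds_y sol).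
have dvb f A : (forall i, velocity m f (i + 1) - velocity m f i = h * A (i + 1)) ->
    (forall i, `|A i| <= M) ->
    forall i, `|velocity m f (i + 1) - velocity m f i| <= h * M.
  by move=> E Ab i; rewrite E normrM ger0_norm // ler_wpM2l.
have [perX perY] := discrete_solution_periodic sol.
have vxb := velocity_bound m0 M_ge0 (ds_xN sol) perX (dvb _ _ dvx axb).
have vyb := velocity_bound m0 M_ge0 (ds_yN sol) perY (dvb _ _ dvy ayb).
have lipf f : (forall i, `|f i| <= 3) -> (forall i, `|velocity m f i| <= 5 * M) ->
    lip h B f.
  move=> f3 vb i; split; first by apply: le_trans (f3 i) _; rewrite /B; lra.
  have -> : f (i + 1) - f i = h * velocity m f i.
    by rewrite /velocity /h; field; rewrite gt_eqF.
  rewrite normrM ger0_norm // ler_wpM2l //; apply: le_trans (vb i) _.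
  by rewrite /B; lra.
have lX : lip h B X by apply: lipf => // i; case: (ds_bound sol i).
have lY : lip h B Y by apply: lipf => // i; case: (ds_bound sol i).
have lv f : (forall i, `|velocity m f i| <= 5 * M) ->
    (forall i, `|velocity m f (i + 1) - velocity m f i| <= h * M) -> lip h B (velocity m f).
  move=> vb db i; split; first by apply: le_trans (vb i) _; rewrite /B; lra.
  by apply: le_trans (db i) _; rewrite ler_wpM2l // /B; lra.
have B20 : 0 <= 2 * B by lra.
have lxy : lip h K (fun i => (xy_dist e X Y i ^+ 3)^-1).
  apply: lip_inv_cube => // [i|i]; first by case: (cd i).
  exact: soft_norm_lip_seq.
have lyz : lip h K (fun i => (yz_dist m e Y i ^+ 3)^-1).
  apply: lip_inv_cube => // [i|i]; first by case: (cd i).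
  exact: (soft_norm_lip_seq e h0 lY (lip_reflect m%:Z lY)).
have lacc f g1 g2 : lip h B f -> lip h K g1 -> lip h K g2 ->
    lip h (2 * (B * (K + K))) (fun i => - (f i / 4 * (g1 i + g2 i))).
  move=> lf l1 l2.
  have q : `|- 4^-1 : R| <= 1 by rewrite normrN ger0_norm ?invr_ge0 //; lra.
  have := lip_scale q (lipM lf (lipD l1 l2)).
  move=> H i; have := H i.
  have E j : - 4^-1 * (f j * (g1 j + g2 j)) = - (f j / 4 * (g1 j + g2 j)) by ring.
  by rewrite !E.
split=> //.
- by apply: lip_widen lX => //; lra.
- by apply: lip_widen lY => //; lra.
- by apply: (lip_widen h0 _ (lv _ vxb (dvb _ _ dvx axb))); lra.
- by apply: (lip_widen h0 _ (lv _ vyb (dvb _ _ dvy ayb))); lra.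
- by apply: (lip_widen h0 _ (lacc _ _ _ lX lxy (lip_reflect m%:Z lxy))); lra.
- by apply: (lip_widen h0 _ (lacc _ _ _ lY lxy lyz)); lra.
Qed.

(** A grid function a whose increments are h b up to O(h^2), with b Lipschitz,
obeys the first order Taylor estimate at every distance, with constants
independent of h. *)
Lemma discrete_taylor h D (a b : int -> R) : 0 <= h -> 0 <= D ->
  (forall i, `|a (i + 1) - a i - h * b i| <= h ^+ 2 * D) ->
  (forall i, `|b (i + 1) - b i| <= h * D) ->
  forall i j, `|a j - a i - ((j - i)%:~R * h) * b i| <= 2 * D * ((j - i)%:~R * h) ^+ 2.
Proof.
move=> h0 D0 ab bb.
have bn i (n : nat) : `|b (i + n%:Z) - b i| <= n%:R * h * D.
  elim: n => [|n IH]; first by rewrite addr0 subrr normr0 !mul0r.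
  have := bb (i + n%:Z); have -> : i + n%:Z + 1 = i + n.+1%:Z by lia.
  rewrite -natr1 => H.
  have := ler_normD (b (i + n.+1%:Z) - b (i + n%:Z)) (b (i + n%:Z) - b i).
  by rewrite addrA subrK; lra.
have fwd i (n : nat) : `|a (i + n%:Z) - a i - (n%:R * h) * b i| <= D * (n%:R * h) ^+ 2.
  elim: n => [|n IH]; first by rewrite addr0 subrr !mul0r subr0 normr0 expr0n mulr0.
  have := ab (i + n%:Z); have -> : i + n%:Z + 1 = i + n.+1%:Z by lia.
  move=> H; have {}bn := ler_wpM2l h0 (bn i n).
  rewrite -{1}(ger0_norm h0) -normrM in bn.
  have -> : a (i + n.+1%:Z) - a i - n.+1%:R * h * b i =
    (a (i + n%:Z) - a i - n%:R * h * b i) +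
    (a (i + n.+1%:Z) - a (i + n%:Z) - h * b (i + n%:Z)) + h * (b (i + n%:Z) - b i).
    by rewrite -natr1; ring.
  apply: le_trans (ler_normD _ _) _; apply: le_trans (lerD (ler_normD _ _) (lexx _)) _.
  apply: le_trans (lerD (lerD IH H) bn) _.
  rewrite -natr1; have := mulr_ge0 (mulr_ge0 (ler0n R n) D0) (sqr_ge0 h); lra.
move=> i j; have [ij|ji] := leP i j.
  have -> : j = i + (absz (j - i))%:Z by lia.
  set n := absz _; have -> : i + n%:Z - i = n%:Z by lia.
  apply: le_trans (fwd i n) _; rewrite -pmulrn ler_wpM2r ?sqr_ge0 //; lra.
have -> : i = j + (absz (i - j))%:Z by lia.
set n := absz _; have -> : j - (j + n%:Z) = - n%:Z by lia.
rewrite mulrNz -pmulrn.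
have H := fwd j n; have H2 := bn j n.
have N0 : 0 <= n%:R * h by rewrite mulr_ge0.
have {}H2 := ler_wpM2l N0 H2; rewrite -{1}(ger0_norm N0) -normrM in H2.
have -> : a j - a (j + n%:Z) - - n%:R * h * b (j + n%:Z) =
  - (a (j + n%:Z) - a j - n%:R * h * b j) + n%:R * h * (b (j + n%:Z) - b j) by ring.
apply: le_trans (ler_normD _ _) _; rewrite normrN.
by apply: le_trans (lerD H H2) _; lra.
Qed.
End DiscreteRegularity.

(** * From the grid to the line *)

Section ContinuousLimit.
Context (R : realType).

Lemma quadratic_bound_is_derive (A : R -> R) (b C t : R) :
  (forall s, `|A s - A t - (s - t) * b| <= C * (s - t) ^+ 2) ->
  is_derive t 1 A b.
Proof.
move=> H; have C0 : 0 <= C.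
  have := H (t + 1); rewrite [t + 1 - t]addrAC subrr add0r expr1n mulr1.
  exact: le_trans.
have lim : (fun h => h^-1 *: (A (h *: 1 + t) - A t)) @ 0^' --> b.
  apply/cvgrPdist_le => e e0; near=> h.
  have h0 : h != 0 by near: h; exact: nbhs_dnbhs_neq.
  have hn : 0 < `|h| by rewrite normr_gt0.
  have hs : `|h| <= e / (C + 1).
    near: h; apply: dnbhs0_le; rewrite divr_gt0 //; lra.
  have := H (h *: 1 + t).
  have -> : h *: 1 + t - t = h by rewrite addrK /GRing.scale /= mulr1.
  have -> : b - h^-1 *: (A (h *: 1 + t) - A t) =
     - (h^-1 * (A (h *: 1 + t) - A t - h * b)).
    rewrite /GRing.scale /=; field; exact: h0.
  move=> Hh; rewrite normrN normrM normfV mulrC ler_pdivrMr //.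
  apply: le_trans Hh _; rewrite -real_normK ?num_real // expr2 mulrA ler_pM2r //.
  apply: le_trans (ler_wpM2l C0 hs) _.
  rewrite mulrCA ler_piMr ?(ltW e0) // ler_pdivrMr; lra.
apply: DeriveDef; last exact: cvg_lim lim.
by apply/cvg_ex; exists b.
Unshelve. all: by end_near. Qed.

(** An even number of steps, at least 1200, as the level estimates require. *)
Definition grid (N : nat) : nat := (N + 600).*2.
Definition grid_index (N : nat) (t : R) : int := Num.floor (t * (grid N)%:R).

Lemma grid_gt0 N : (0 < grid N)%N.
Proof. by rewrite double_gt0 addn_gt0 orbT. Qed.

Lemma grid_index_itv N (t : R) : (grid_index N t)%:~R <= t * (grid N)%:R /\
  t * (grid N)%:R < (grid_index N t)%:~R + 1.
Proof.
rewrite /grid_index; split; first exact: ge_floor.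
by rewrite -[1]/(1%:~R) -intrD; exact: floorD1_gt.
Qed.

Lemma cvg_mesh (F : set_system nat) : Filter F -> \oo `<=` F ->
  (fun N => (grid N)%:R^-1 : R) @ F --> (0 : R).
Proof.
move=> FF Foo.
have H : (fun N => (grid N)%:R^-1 : R) @ \oo --> (0 : R).
  apply: (@squeeze_cvgr _ _ _ _ (fun=> 0) (@harmonic R)).
  - apply: nearW => N; rewrite invr_ge0 ler0n /= /harmonic /= lef_pV2 ?posrE ?ltr0n ?grid_gt0 //.
    rewrite ler_nat /grid; lia.
  - exact: cvg_cst.
  - exact: cvg_harmonic.
by move=> A /H; exact: Foo.
Qed.

Section Limit.
Context (F : set_system nat) (FU : UltraFilter F) (Foo : \oo `<=` F).

Lemma cvg_grid_index (t : R) :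
  (fun N => (grid_index N t)%:~R * (grid N)%:R^-1) @ F --> t.
Proof.
have Z : (fun N => t - (grid_index N t)%:~R * (grid N)%:R^-1) @ F --> (0 : R).
  apply: (@squeeze_cvgr _ _ _ _ (fun=> 0) (fun N => (grid N)%:R^-1)).
  - apply: nearW => N; have [a b] := grid_index_itv N t.
    have M0 : 0 < (grid N)%:R :> R by rewrite ltr0n grid_gt0.
    rewrite subr_ge0 ler_pdivrMr // a /= lerBlDr.
    rewrite -[X in _ <= X + _]mul1r -mulrDl ler_pdivlMr //; lra.
  - exact: cvg_cst.
  - exact: cvg_mesh.
have -> : (fun N => (grid_index N t)%:~R * (grid N)%:R^-1) =
    (fun N => t - (t - (grid_index N t)%:~R * (grid N)%:R^-1)).
  by apply/funext => N; rewrite subKr.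
by rewrite -[X in _ --> X]subr0; apply: cvgB => //; exact: cvg_cst.
Qed.

Definition limit_of (D : R) (a : nat -> int -> R) (A : R -> R) :=
  (forall N, lip (grid N)%:R^-1 D (a N)) /\
  forall t, (fun N => a N (grid_index N t)) @ F --> A t.

Lemma limit_of_exists D (a : nat -> int -> R) :
  (forall N, lip (grid N)%:R^-1 D (a N)) -> exists A, limit_of D a A.
Proof.
move=> lipa.
have H (t : R) : exists l : R, (fun N => a N (grid_index N t)) @ F --> l.
  apply: (ultra_bounded_cvg (B := D)); apply: nearW => N.
  by have [] := lipa N (grid_index N t).
by have [A HA] := choice H; exists A.
Qed.

(** The limit depends only on the time, not on the choice of the grid point near
it, by the uniform Lipschitz bound. *)
Lemma limit_of_shift D a A (t : R) (j : nat -> int) : limit_of D a A ->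
  (forall N, grid_index N t - 1 <= j N <= grid_index N t + 1) ->
  (fun N => a N (j N)) @ F --> A t.
Proof.
move=> [la cA] jN.
have D0 : 0 <= D by exact: lip_ge0 (la 0%N).
have Z : (fun N => a N (j N) - a N (grid_index N t)) @ F --> (0 : R).
  have mZ : (fun N => - ((grid N)%:R^-1 * D)) @ F --> - (0 * D).
    by apply: cvgN; apply: cvgMl; exact: cvg_mesh.
  have pZ : (fun N => (grid N)%:R^-1 * D) @ F --> 0 * D.
    by apply: cvgMl; exact: cvg_mesh.
  rewrite mul0r ?oppr0 in mZ pZ.
  apply: (squeeze_cvgr _ mZ pZ); apply: nearW => N.
  rewrite -ler_norml; have := jN N; set i := grid_index N t => /andP[j1 j2].
  have : j N = i - 1 \/ j N = i \/ j N = i + 1 by lia.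
  move=> [->|[->|->]].
  - by have [_] := la N (i - 1); rewrite subrK distrC.
  - by rewrite subrr normr0 mulr_ge0.
  - by have [] := la N i.
have -> : (fun N => a N (j N)) =
    (fun N => (a N (j N) - a N (grid_index N t)) + a N (grid_index N t)).
  by apply/funext => N; rewrite subrK.
by rewrite -[X in _ --> X]add0r; apply: cvgD => //; exact: cA.
Qed.

Lemma limit_of_derive D a b A B : limit_of D a A -> limit_of D b B ->
  (forall N i, `|a N (i + 1) - a N i - (grid N)%:R^-1 * b N i| <= (grid N)%:R^-1 ^+ 2 * D) ->
  forall t : R, is_derive t 1 A (B t).
Proof.
move=> [la cA] [lb cB] ab t; have D0 : 0 <= D by exact: lip_ge0 (la 0%N).
apply: (@quadratic_bound_is_derive _ _ (2 * D)) => s.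
have T N : let i := grid_index N t in let j := grid_index N s in
    `|a N j - a N i - (j%:~R * (grid N)%:R^-1 - i%:~R * (grid N)%:R^-1) * b N i| <=
    2 * D * (j%:~R * (grid N)%:R^-1 - i%:~R * (grid N)%:R^-1) ^+ 2.
  move=> i j; rewrite -mulrBl -intrB; apply: discrete_taylor => //.
  by move=> k; have [] := lb N k.
have cd : (fun N => (grid_index N s)%:~R * (grid N)%:R^-1 -
    (grid_index N t)%:~R * (grid N)%:R^-1) @ F --> s - t.
  by apply: cvgB; exact: cvg_grid_index.
have L : (fun N => `|a N (grid_index N s) - a N (grid_index N t) -
    ((grid_index N s)%:~R * (grid N)%:R^-1 - (grid_index N t)%:~R * (grid N)%:R^-1) *
    b N (grid_index N t)|) @ F --> `|A s - A t - (s - t) * B t|.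
  apply: cvg_norm; apply: cvgB; first by apply: cvgB; exact: cA.
  by apply: cvgM => //; exact: cB.
have L2 : (fun N => 2 * D * ((grid_index N s)%:~R * (grid N)%:R^-1 -
    (grid_index N t)%:~R * (grid N)%:R^-1) ^+ 2) @ F --> 2 * D * (s - t) ^+ 2.
  under eq_fun do rewrite expr2; rewrite expr2.
  by apply: cvgMr; exact: cvgM.
by apply: (ler_cvg_to L L2); apply: nearW => N; exact: T.
Qed.
End Limit.
End ContinuousLimit.

(** * The reduced boundary value problem *)

Section ReducedSolution.
Context (R : realType).

Definition planar_norm (a b : R) : R := Num.sqrt (a ^+ 2 + b ^+ 2).

Lemma soft_norm0 a b : soft_norm 0 a b = planar_norm a b.
Proof. by rewrite /soft_norm expr0n addr0. Qed.

(** The third coordinate is z(t) = y(1 - t), and z(1 - t) = y(t), x(1 - t) = - x(t)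
turn the norm of (x, y) at time 1 - t into that of (x, z) at time t. *)
Record reduced_solution (X Y : R -> R) : Prop := {
  rd_xN : forall t, X (- t) = X t;
  rd_xB : forall t, X (1 - t) = - X t;
  rd_yN : forall t, Y (- t) = Y t;
  rd_yB : forall t, Y (2 - t) = - Y t;
  rd_xy : forall t, 0 < planar_norm (X t) (Y t);
  rd_yz : forall t, 0 < planar_norm (Y t) (Y (1 - t));
  rd_x : exists2 V : R -> R, (forall t : R, is_derive t 1 X (V t)) &
    forall t : R, is_derive t 1 V
      (- (X t / 4 * ((planar_norm (X t) (Y t) ^+ 3)^-1 +
                     (planar_norm (X t) (Y (1 - t)) ^+ 3)^-1)));
  rd_y : exists2 V : R -> R, (forall t : R, is_derive t 1 Y (V t)) &
    forall t : R, is_derive t 1 V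
      (- (Y t / 4 * ((planar_norm (X t) (Y t) ^+ 3)^-1 +
                     (planar_norm (Y t) (Y (1 - t)) ^+ 3)^-1)))
}.

Lemma grid_index_reflect N (t : R) (k : nat) :
  grid_index N (k%:R - t) - 1 <= (k * grid N)%N%:Z - grid_index N t <=
  grid_index N (k%:R - t) + 1.
Proof.
have [a b] := grid_index_itv N t; have [c d] := grid_index_itv N (k%:R - t).
set i := grid_index N t in a b *; set j := grid_index N (k%:R - t) in c d *.
have E : (k%:R - t) * (grid N)%:R = (k * grid N)%N%:Z%:~R - t * (grid N)%:R.
  by rewrite mulrBl -pmulrn natrM.
rewrite E in c d.
have h1 : (j + i)%:~R < ((k * grid N)%N%:Z + 1)%:~R :> R by rewrite !intrD; lra.
have h2 : ((k * grid N)%N%:Z)%:~R < (j + i + 2)%:~R :> R by rewrite !intrD; lra.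
rewrite !ltr_int in h1 h2; clear -h1 h2; lia.
Qed.

(** The softening parameter is the mesh, so it disappears in the limit together
with the discretisation. *)
Lemma exists_reduced_solution : exists X Y, reduced_solution X Y.
Proof.
have [D HD] := discrete_solution_regular R.
have sols N : exists XY : (int -> R) * (int -> R),
    regular_solution (grid N) (grid N)%:R^-1 D XY.1 XY.2.
  have M0 : 0 < (grid N)%:R^-1 :> R by rewrite invr_gt0 ltr0n grid_gt0.
  have [||X [Y sol]] := @exists_discrete_solution R (N + 600) _ _ M0.
  - by rewrite leq_addl.
  - rewrite div1r lef_pV2 ?posrE ?ltr0n ?grid_gt0 // ler_nat /grid; lia.
  by exists (X, Y); apply: HD => //; exact: grid_gt0.
have [XY HXY] := choice sols.
have [F [FU Foo]] := exists_ultrafilter_infty.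
pose x N := (XY N).1; pose y N := (XY N).2.
have rs N : regular_solution (grid N) (grid N)%:R^-1 D (x N) (y N) by exact: HXY.
have [X LX] := limit_of_exists FU (fun N => rs_x (rs N)).
have [Y LY] := limit_of_exists FU (fun N => rs_y (rs N)).
have [VX LVX] := limit_of_exists FU (fun N => rs_vx (rs N)).
have [VY LVY] := limit_of_exists FU (fun N => rs_vy (rs N)).
have [AX LAX] := limit_of_exists FU (fun N => rs_ax (rs N)).
have [AY LAY] := limit_of_exists FU (fun N => rs_ay (rs N)).
have D0 : 0 <= D by exact: lip_ge0 (rs_x (rs 0%N)).
have dpos a A v V : limit_of F D a A -> limit_of F D v V ->
    (forall N, v N = velocity (grid N) (a N)) -> forall t : R, is_derive t 1 A (V t).
  move=> LA LV vE; apply: (limit_of_derive FU Foo LA LV) => N i.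
  have M0 : (grid N)%:R != 0 :> R by rewrite pnatr_eq0 -lt0n grid_gt0.
  rewrite vE /velocity mulrC mulfK // subrr normr0 mulr_ge0 ?sqr_ge0 //.
have dvel v V a A : limit_of F D v V -> limit_of F D a A ->
    (forall N i, v N (i + 1) - v N i = (grid N)%:R^-1 * a N (i + 1)) ->
    forall t : R, is_derive t 1 V (A t).
  move=> LV [la cA] vE; apply: (limit_of_derive FU Foo LV (conj la cA)) => N i.
  rewrite vE -mulrBr normrM ger0_norm ?invr_ge0 // expr2 -mulrA.
  by rewrite ler_wpM2l ?invr_ge0 //; have [] := la N i.
(* Grid points reflect to grid points, whereas the integer part of the reflected
   time may differ by one from the reflected integer part. *)
have refl k (t : R) a A : limit_of F D a A ->
    (fun N => a N ((k * grid N)%N%:Z - grid_index N t)) @ F --> A (k%:R - t).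
  move=> LA; apply: (limit_of_shift FU Foo LA) => N; exact: grid_index_reflect.
have dist (a b : nat -> R) (A B : R) : a @ F --> A -> b @ F --> B ->
    (fun N => soft_norm (grid N)%:R^-1 (a N) (b N)) @ F --> planar_norm A B.
  move=> aA bB; rewrite -soft_norm0; apply: cvg_soft_norm => //.
  exact: cvg_mesh.
have cX := LX.2; have cY := LY.2.
have rX t : (fun N => x N ((grid N)%:Z - grid_index N t)) @ F --> X (1 - t).
  by have := refl 1%N t _ _ LX; under eq_fun do rewrite mul1n.
have rY t : (fun N => y N ((grid N)%:Z - grid_index N t)) @ F --> Y (1 - t).
  by have := refl 1%N t _ _ LY; under eq_fun do rewrite mul1n.
have xN t : X (- t) = X t.
  apply: (@cvg_real_unique _ _ F (fun N => x N (0%N%:Z - grid_index N t))) => //.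
    by have := refl 0%N t _ _ LX; rewrite sub0r; under eq_fun do rewrite mul0n.
  under eq_fun do rewrite sub0r (ds_xN (rs_sol (rs _))); exact: cX.
have yN t : Y (- t) = Y t.
  apply: (@cvg_real_unique _ _ F (fun N => y N (0%N%:Z - grid_index N t))) => //.
    by have := refl 0%N t _ _ LY; rewrite sub0r; under eq_fun do rewrite mul0n.
  under eq_fun do rewrite sub0r (ds_yN (rs_sol (rs _))); exact: cY.
have xB t : X (1 - t) = - X t.
  apply: (@cvg_real_unique _ _ F _ _ _ _ (rX t)) => //.
  under eq_fun do rewrite (ds_xB (rs_sol (rs _))); apply: cvgN; exact: cX.
have yB t : Y (2 - t) = - Y t.
  apply: (@cvg_real_unique _ _ F (fun N => y N ((2 * grid N)%N%:Z - grid_index N t))) => //.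
    exact: (refl 2%N t _ _ LY).
  under eq_fun do rewrite mul2n (ds_yB (rs_sol (rs _))).
  by apply: cvgN; exact: cY.
have dxy t : (fun N => xy_dist (grid N)%:R^-1 (x N) (y N) (grid_index N t)) @ F -->
    planar_norm (X t) (Y t).
  by apply: dist.
have dxz t : (fun N => xy_dist (grid N)%:R^-1 (x N) (y N) ((grid N)%:Z - grid_index N t)) @ F -->
    planar_norm (X (1 - t)) (Y (1 - t)).
  by apply: dist.
have dyz t : (fun N => yz_dist (grid N) (grid N)%:R^-1 (y N) (grid_index N t)) @ F -->
    planar_norm (Y t) (Y (1 - t)).
  by apply: dist.
have [c c0 cE] : exists2 c : R, 0 < c & c = 1 / 1000 ^+ 2.
  by exists (1 / 1000 ^+ 2); first lra.
have lowb (r : nat -> R) (l : R) : (forall N, c <= r N) -> r @ F --> l -> 0 < l.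
  move=> cr rl; apply: lt_le_trans c0 _.
  by apply: (ler_cvg_to (cvg_cst c) rl); apply: nearW.
have pxy t : 0 < planar_norm (X t) (Y t).
  apply: lowb (dxy t) => N; rewrite cE.
  by have [] := ds_dist (rs_sol (rs N)) (grid_index N t).
have pyz t : 0 < planar_norm (Y t) (Y (1 - t)).
  apply: lowb (dyz t) => N; rewrite cE.
  by have [] := ds_dist (rs_sol (rs N)) (grid_index N t).
have inv3 (r : nat -> R) (l : R) : r @ F --> l -> 0 < l ->
    (fun N => (r N ^+ 3)^-1) @ F --> (l ^+ 3)^-1.
  move=> rl l0; apply: cvgV; first by rewrite gt_eqF // exprn_gt0.
  by under eq_fun do rewrite !exprS expr0 mulr1; rewrite !exprS expr0 mulr1;
    apply: cvgM => //; exact: cvgM.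
have acc (z r s : nat -> R) (lz lr ls : R) : z @ F --> lz -> r @ F --> lr -> s @ F --> ls ->
    0 < lr -> 0 < ls ->
    (fun N => - (z N / 4 * ((r N ^+ 3)^-1 + (s N ^+ 3)^-1))) @ F -->
    - (lz / 4 * ((lr ^+ 3)^-1 + (ls ^+ 3)^-1)).
  move=> zl rl sl r0 s0; apply: cvgN; apply: cvgM; first by apply: cvgMl.
  by apply: cvgD; exact: inv3.
exists X, Y; split=> //.
- exists VX; first exact: (dpos _ _ _ _ LX LVX).
  move=> t; have -> : - (X t / 4 * ((planar_norm (X t) (Y t) ^+ 3)^-1 +
      (planar_norm (X t) (Y (1 - t)) ^+ 3)^-1)) = AX t.
    have -> : planar_norm (X t) (Y (1 - t)) = planar_norm (X (1 - t)) (Y (1 - t)).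
      by rewrite /planar_norm xB sqrrN.
    apply: (@cvg_real_unique _ _ F _ _ _ _ _ (LAX.2 t)) => //.
    by apply: acc => //; exact: cX.
  exact: (dvel _ _ _ _ LVX LAX (fun N => rs_dvx (rs N))).
- exists VY; first exact: (dpos _ _ _ _ LY LVY).
  move=> t; have -> : - (Y t / 4 * ((planar_norm (X t) (Y t) ^+ 3)^-1 +
      (planar_norm (Y t) (Y (1 - t)) ^+ 3)^-1)) = AY t.
    apply: (@cvg_real_unique _ _ F _ _ _ _ _ (LAY.2 t)) => //.
    by apply: acc => //; exact: cY.
  exact: (dvel _ _ _ _ LVY LAY (fun N => rs_dvy (rs N))).
Qed.
End ReducedSolution.

(** * Smooth periodic functions belong to the Sobolev space *)

Section H1Smooth.
Context (R : realType).

Lemma continuous_L2_period (T : R) (f : R -> R) : continuous f -> L2_period T f.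
Proof.
move=> cf; rewrite /L2_period inE; apply/andP; split; rewrite inE /=.
  have mf : measurable_fun [set` `[0, T]] f.
    apply: subspace_continuous_measurable_fun; [exact: measurable_itv|exact: continuous_subspaceT].
  by apply/(measurable_restrictT _ _).1 => //; exact: measurable_itv.
rewrite /finite_norm unlock; apply: poweR_lty.
have -> : (\int[lebesgue_measure]_x (`|(EFin \o f \_ `[0%R, T]) x| `^ 2))%E =
    (\int[lebesgue_measure]_(x in `[0%R, T]) (f x * f x)%:E)%E.
  rewrite [RHS]integral_mkcond; apply: eq_integral => x _.
  rewrite patchE /= patchE; case: ifPn => _.
    by rewrite powR_mulrn // real_normK ?num_real // expr2.
  by rewrite normr0 powR0 ?pnatr_eq0.
apply: integrable_lty; first exact: measurable_itv.
have := @continuous_compact_integrable R (fun x => f x * f x) `[0, T]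
  (@segment_compact _ _ _).
apply; apply: continuous_subspaceT => x.
by apply: cvgM; exact: cf.
Qed.

Lemma is_derive_continuous (f df : R -> R) :
  (forall t : R, is_derive t 1 f (df t)) -> continuous f.
Proof.
move=> H t; apply: differentiable_continuous; apply/derivable1_diffP.
by case: (H t).
Qed.

(** The classical derivative is a weak one: integrate by parts over a period, where
the boundary terms cancel. *)
Lemma C1_H1_period (T : R) (f g : R -> R) : 0 < T ->
  (forall t : R, is_derive t 1 f (g t)) -> continuous g -> periodic f T ->
  H1_period T f.
Proof.
move=> T0 fg cg fT; have cf := is_derive_continuous fg.
split=> //; first exact: continuous_L2_period.
exists g; first exact: continuous_L2_period.
move=> phi sphi pphi.
have dphi (t : R) : derivable phi t 1 by exact: (sphi 0%N t).
have ddphi (t : R) : derivable (derive1 phi) t 1 by exact: (sphi 1%N t).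
have cphi : continuous phi.
  by move=> t; apply: differentiable_continuous; apply/derivable1_diffP.
have cdphi : continuous (derive1 phi).
  by move=> t; apply: differentiable_continuous; apply/derivable1_diffP.
have LR (h : R -> R) : (forall t : R, derivable h t 1) -> continuous h ->
    derivable_oo_LRcontinuous h 0 T.
  move=> dh ch; split=> [t _||]; first exact: dh.
    by apply: cvg_at_right_filter; exact: ch.
  by apply: cvg_at_left_filter; exact: ch.
have df (t : R) : derivable f t 1 by have [] := fg t.
have fE : {in `]0, T[, derive1 f =1 g}.
  by move=> t _; rewrite derive1E; have [] := fg t.
have phiE : {in `]0, T[, derive1 phi =1 derive1 phi} by [].
have fLR := LR f df cf; have phiLR := LR phi dphi cphi.
have cg' : {within `[0, T], continuous g} by exact: continuous_subspaceT.
have cdphi' : {within `[0, T], continuous (derive1 phi)}.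
  exact: continuous_subspaceT.
rewrite (Rintegration_by_parts T0 cg' fLR fE cdphi' phiLR phiE).
have -> : f T * phi T - f 0 * phi 0 = 0.
  by have := fT 0; have := pphi 0; rewrite add0r => -> ->; exact: subrr.
by rewrite sub0r.
Qed.
End H1Smooth.

(** * The four bodies *)

Section Bodies.
Context (R : realType).

(** The half turns about the axes act on the coordinates by these signs. *)
Definition body_sign (i : 'I_4) (k : 'I_3) : R :=
  nth 0 (nth [::] [:: [:: 1; 1; 1]; [:: -1; -1; 1]; [:: 1; -1; -1]; [:: -1; 1; -1]] i) k.

Definition coord (x y z : R) (k : 'I_3) : R := nth 0 [:: x; y; z] k.

Definition body (x y z : R) (i : 'I_4) : 'rV[R]_3 :=
  \row_k (body_sign i k * coord x y z k).

Lemma ord3P (k : 'I_3) : [\/ k = 0, k = 1 | k = 2].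
Proof.
case: k => -[|[|[|//]]] kP.
- by apply: Or31; apply: val_inj.
- by apply: Or32; apply: val_inj.
- by apply: Or33; apply: val_inj.
Qed.

Lemma ord4P (i : 'I_4) : [\/ i = 0, i = 1, i = 2 | i = 3].
Proof.
case: i => -[|[|[|[|//]]]] iP.
- by apply: Or41; apply: val_inj.
- by apply: Or42; apply: val_inj.
- by apply: Or43; apply: val_inj.
- by apply: Or44; apply: val_inj.
Qed.

Lemma sum_ord3 (V : nmodType) (F : 'I_3 -> V) : \sum_k F k = F 0 + F 1 + F 2.
Proof.
rewrite !big_ord_recr big_ord0 /= add0r.
by congr (F _ + F _ + F _); apply: val_inj.
Qed.

Lemma sum_ord4 (V : nmodType) (F : 'I_4 -> V) :
  \sum_i F i = F 0 + F 1 + F 2 + F 3.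
Proof.
rewrite !big_ord_recr big_ord0 /= add0r.
by congr (F _ + F _ + F _ + F _); apply: val_inj.
Qed.

Lemma coordE (x y z : R) :
  (coord x y z 0 = x) * (coord x y z 1 = y) * (coord x y z 2 = z).
Proof. by []. Qed.

Lemma body_signE :
  (body_sign 0 0 = 1) * (body_sign 0 1 = 1) * (body_sign 0 2 = 1) *
  (body_sign 1 0 = -1) * (body_sign 1 1 = -1) * (body_sign 1 2 = 1) *
  (body_sign 2 0 = 1) * (body_sign 2 1 = -1) * (body_sign 2 2 = -1) *
  (body_sign 3 0 = -1) * (body_sign 3 1 = 1) * (body_sign 3 2 = -1).
Proof. by []. Qed.

Lemma eucl_norm_body_diff (x y z : R) (i j : 'I_4) :
  eucl_norm (body x y z j - body x y z i) =
  Num.sqrt (((body_sign j 0 - body_sign i 0) * x) ^+ 2 +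
            ((body_sign j 1 - body_sign i 1) * y) ^+ 2 +
            ((body_sign j 2 - body_sign i 2) * z) ^+ 2).
Proof. by rewrite /eucl_norm sum_ord3 !mxE !coordE -!mulrBl. Qed.

Lemma sqrt_quadruple (s a b : R) : s = 4 * (a ^+ 2 + b ^+ 2) ->
  Num.sqrt s = 2 * planar_norm a b.
Proof.
move=> ->; rewrite sqrtrM // /planar_norm; congr (_ * _).
have -> : 4 = 2 ^+ 2 :> R by ring.
by rewrite sqrtr_sqr ger0_norm.
Qed.

(** Half the distances: two bodies differ by the sign of exactly two coordinates. *)
Definition pair_dist (x y z : R) (i j : 'I_4) : R :=
  nth 0 (nth [::] [:: [:: 0; planar_norm x y; planar_norm y z; planar_norm x z];
    [:: planar_norm x y; 0; planar_norm x z; planar_norm y z];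
    [:: planar_norm y z; planar_norm x z; 0; planar_norm x y];
    [:: planar_norm x z; planar_norm y z; planar_norm x y; 0]] i) j.

Lemma eucl_norm_bodyE (x y z : R) (i j : 'I_4) :
  eucl_norm (body x y z j - body x y z i) = 2 * pair_dist x y z i j.
Proof.
rewrite eucl_norm_body_diff.
have [] := ord4P i; have [] := ord4P j => -> ->; rewrite !body_signE;
  try (apply: sqrt_quadruple; ring).
all: by rewrite !subrr !mul0r !expr0n !addr0 sqrtr0 mulr0.
Qed.

Section Newton.
Context (x y z : R).
Context (xy0 : 0 < planar_norm x y) (yz0 : 0 < planar_norm y z)
  (xz0 : 0 < planar_norm x z).

Lemma pair_dist_gt0 (i j : 'I_4) : j != i -> 0 < pair_dist x y z i j.
Proof. by have [] := ord4P i; have [] := ord4P j => -> ->. Qed.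

Lemma body_neq (i j : 'I_4) : j != i -> body x y z j != body x y z i.
Proof.
move=> ij; apply/eqP => E; have := pair_dist_gt0 ij.
have := eucl_norm_bodyE x y z i j; rewrite E subrr /eucl_norm big1.
  by rewrite sqrtr0 => /eqP; rewrite eq_sym mulf_eq0 pnatr_eq0 /= => /eqP ->; rewrite ltxx.
by move=> k _; rewrite mxE expr0n.
Qed.

(** Each coordinate of the attraction is opposite to that coordinate of the body,
because a body differs in it either not at all or by its double. *)
Lemma body_force (i : 'I_4) :
  \sum_(j < 4 | j != i)
     (eucl_norm (body x y z j - body x y z i) ^+ 3)^-1 *:
       (body x y z j - body x y z i) =
  \row_k (body_sign i k * coord
    (- (x / 4 * ((planar_norm x y ^+ 3)^-1 + (planar_norm x z ^+ 3)^-1)))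
    (- (y / 4 * ((planar_norm x y ^+ 3)^-1 + (planar_norm y z ^+ 3)^-1)))
    (- (z / 4 * ((planar_norm x z ^+ 3)^-1 + (planar_norm y z ^+ 3)^-1))) k).
Proof.
have -> : \sum_(j < 4 | j != i)
     (eucl_norm (body x y z j - body x y z i) ^+ 3)^-1 *:
       (body x y z j - body x y z i) =
   \sum_(j < 4) (eucl_norm (body x y z j - body x y z i) ^+ 3)^-1 *:
       (body x y z j - body x y z i).
  rewrite [RHS](bigID (fun j => j != i)) /= [X in _ = _ + X]big1 ?addr0 //.
  by move=> j; rewrite negbK => /eqP ->; rewrite subrr scaler0.
have nz (p : R) : 0 < p -> p != 0 by move=> p0; rewrite gt_eqF.
apply/rowP => k; rewrite sum_ord4 !mxE !eucl_norm_bodyE /pair_dist.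
move: (nz _ xy0) (nz _ yz0) (nz _ xz0).
move: (planar_norm x y) (planar_norm y z) (planar_norm x z) => p q r p0 q0 r0.
by have [] := ord4P i => ->; have [] := ord3P k => ->;
  rewrite !body_signE !coordE /= ?subrr ?mulr0; field; rewrite ?p0 ?q0 ?r0.
Qed.
End Newton.
End Bodies.

(** * Rescaling and the periodic solution *)

Section Assembly.
Context (R : realType).

Section Derivatives.
Context (x y z dx dy dz : R -> R).
Context (Hx : forall t : R, is_derive t 1 x (dx t))
  (Hy : forall t : R, is_derive t 1 y (dy t)) (Hz : forall t : R, is_derive t 1 z (dz t)).

Lemma is_derive_body_coord (i : 'I_4) (k : 'I_3) (t : R) :
  is_derive t 1 (fun t => body (x t) (y t) (z t) i 0 k)
    (body (dx t) (dy t) (dz t) i 0 k).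
Proof.
have -> : (fun t => body (x t) (y t) (z t) i 0 k) =
    body_sign R i k \*: (fun t => coord (x t) (y t) (z t) k).
  by apply/funext => s; rewrite mxE.
rewrite [X in is_derive _ _ _ X]mxE.
apply: is_deriveZ.
by have [] := ord3P k => ->; [exact: Hx|exact: Hy|exact: Hz].
Qed.

Lemma derivable_body (i : 'I_4) (t : R) :
  derivable (fun t => body (x t) (y t) (z t) i) t 1.
Proof.
apply/derivable_mxP => r k; rewrite ord1.
by have [] := is_derive_body_coord i k t.
Qed.

Lemma derive1_body (i : 'I_4) :
  derive1 (fun t => body (x t) (y t) (z t) i) =
  (fun t => body (dx t) (dy t) (dz t) i).
Proof.
apply/funext => t; rewrite derive1E derive_mx; last exact: derivable_body.
apply/matrixP => r k; rewrite mxE ord1.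
by have [] := is_derive_body_coord i k t.
Qed.

Lemma H1_period_body (T : R) (i : 'I_4) (k : 'I_3) (ddx ddy ddz : R -> R) : 0 < T ->
  (forall t : R, is_derive t 1 dx (ddx t)) ->
  (forall t : R, is_derive t 1 dy (ddy t)) ->
  (forall t : R, is_derive t 1 dz (ddz t)) ->
  periodic x T -> periodic y T -> periodic z T ->
  H1_period T (fun t => body (x t) (y t) (z t) i 0 k).
Proof.
move=> T0 Hdx Hdy Hdz px py pz.
apply: (C1_H1_period T0 (is_derive_body_coord i k)); last first.
  by move=> t; rewrite px py pz.
move=> t; have -> : (fun s => body (dx s) (dy s) (dz s) i 0 k) =
    body_sign R i k \*: (fun s => coord (dx s) (dy s) (dz s) k).
  by apply/funext => s; rewrite mxE.
apply: cvgMr; have [] := ord3P k => ->.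
- exact: (is_derive_continuous Hdx).
- exact: (is_derive_continuous Hdy).
- exact: (is_derive_continuous Hdz).
Qed.
End Derivatives.

Lemma is_derive_rescale (X V : R -> R) (l k c : R) :
  (forall t : R, is_derive t 1 X (V t)) ->
  forall t : R, is_derive t 1 (fun t => l * X (c + k * t)) (l * k * V (c + k * t)).
Proof.
move=> HX t.
have Hg : is_derive t 1 (fun s : R => c + k * s) k.
  have := is_deriveD (is_derive_cst c t 1) (is_deriveZ k (is_derive_id t 1)).
  by rewrite add0r /GRing.scale /= mulr1.
have := is_deriveZ l (@is_derive1_comp _ X (fun s => c + k * s) t _ _ (HX (c + k * t)) Hg).
by rewrite /GRing.scale /= [V _ * k]mulrC mulrA.
Qed.

Lemma planar_normZ (l a b : R) : 0 <= l ->
  planar_norm (l * a) (l * b) = l * planar_norm a b.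
Proof.
move=> l0; rewrite /planar_norm !exprMn -mulrDr sqrtrM ?sqr_ge0 //.
by rewrite sqrtr_sqr ger0_norm.
Qed.

Lemma exists_cube_root (a : R) : 0 < a -> exists2 l : R, 0 < l & l ^+ 3 = a.
Proof.
move=> a0; exists (a `^ 3^-1); first exact: powR_gt0.
by rewrite -powR_mulrn ?powR_ge0 // -powRrM mulVf ?pnatr_eq0 // powRr1 // ltW.
Qed.
End Assembly.

Theorem theorem2p1 (R : realType) (T : R) (T_gt0 : 0 < T) :
  exists u : 'I_4 -> R -> 'rV[R]_3,
    [/\ K4 T u, newton_solution u & forall i : 'I_4, periodic (u i) T].
Proof.
have [X [Y [xN xB yN yB pxy pyz [VX dX dVX] [VY dY dVY]]]] := exists_reduced_solution R.
have T2 : 0 < T ^+ 2 / 16 by rewrite divr_gt0 // exprn_gt0.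
(* Kepler's third law: distances scale by l and times by T / 4, with
   l^3 = (T / 4)^2. *)
have [l l0 l3] := exists_cube_root T2.
pose k := 4 / T; have k0 : k != 0 by rewrite mulf_neq0 ?invr_eq0 ?gt_eqF.
pose x t := l * X (0 + k * t); pose y t := l * Y (0 + k * t).
pose z t := l * Y (1 + - k * t).
have Hx := is_derive_rescale l k 0 dX; have Hy := is_derive_rescale l k 0 dY.
have Hz := is_derive_rescale l (- k) 1 dY.
have Hdx := is_derive_rescale (l * k) k 0 dVX.
have Hdy := is_derive_rescale (l * k) k 0 dVY.
have Hdz := is_derive_rescale (l * - k) (- k) 1 dVY.
have zE t : z t = l * Y (1 - (0 + k * t)) by rewrite /z add0r mulNr.
have X1 t : X (t + 1) = - X t by rewrite -[t in LHS]opprK addrC xB xN.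
have Y2 t : Y (t + 2) = - Y t by rewrite -[t in LHS]opprK addrC yB yN.
have X4 t : X (t + 4) = X t.
  have -> : t + 4 = t + 1 + 1 + 1 + 1 by ring.
  by rewrite !X1 !opprK.
have Y4 t : Y (t + 4) = Y t.
  have -> : t + 4 = t + 2 + 2 by ring.
  by rewrite !Y2 opprK.
have kT : k * T = 4 by rewrite /k mulfVK // gt_eqF.
have px : periodic x T by move=> t; rewrite /x mulrDr kT addrA X4.
have py : periodic y T by move=> t; rewrite /y mulrDr kT addrA Y4.
have pz : periodic z T.
  move=> t; rewrite /z -[in LHS]Y4; congr (_ * Y _).
  by rewrite -kT; ring.
pose u (i : 'I_4) (t : R) : 'rV[R]_3 := body (x t) (y t) (z t) i.
pose ax t : R := - (x t / 4 * ((planar_norm (x t) (y t) ^+ 3)^-1 +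
                               (planar_norm (x t) (z t) ^+ 3)^-1)).
pose ay t : R := - (y t / 4 * ((planar_norm (x t) (y t) ^+ 3)^-1 +
                               (planar_norm (y t) (z t) ^+ 3)^-1)).
pose az t : R := - (z t / 4 * ((planar_norm (x t) (z t) ^+ 3)^-1 +
                               (planar_norm (y t) (z t) ^+ 3)^-1)).
have planarC (a b : R) : planar_norm a b = planar_norm b a.
  by rewrite /planar_norm addrC.
have planarN (a b : R) : planar_norm (- a) b = planar_norm a b.
  by rewrite /planar_norm sqrrN.
have pxz s : 0 < planar_norm (X s) (Y (1 - s)).
  by have := pxy (1 - s); rewrite xB planarN.
have kl : k ^+ 2 = (l ^+ 3)^-1.
  by rewrite l3 /k; field; rewrite gt_eqF.
have scale3 (a b : R) :
    (planar_norm (l * a) (l * b) ^+ 3)^-1 = k ^+ 2 * (planar_norm a b ^+ 3)^-1.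
  by rewrite planar_normZ ?(ltW l0) // exprMn invfM kl.
pose s (t : R) : R := 0 + k * t.
have zs t : z t = l * Y (1 - s t) by exact: zE.
have Hax (t : R) : is_derive t 1 (fun t : R => l * k * VX (0 + k * t)) (ax t).
  suff -> : ax t = l * k * k * - (X (s t) / 4 * ((planar_norm (X (s t)) (Y (s t)) ^+ 3)^-1 +
      (planar_norm (X (s t)) (Y (1 - s t)) ^+ 3)^-1)) by exact: Hdx.
  by rewrite /ax zs /x /y !scale3 -/(s t); ring.
have Hay (t : R) : is_derive t 1 (fun t : R => l * k * VY (0 + k * t)) (ay t).
  suff -> : ay t = l * k * k * - (Y (s t) / 4 * ((planar_norm (X (s t)) (Y (s t)) ^+ 3)^-1 +
      (planar_norm (Y (s t)) (Y (1 - s t)) ^+ 3)^-1)) by exact: Hdy.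
  by rewrite /ay zs /x /y !scale3 -/(s t); ring.
have Haz (t : R) : is_derive t 1 (fun t : R => l * - k * VY (1 + - k * t)) (az t).
  have s' : 1 + - k * t = 1 - s t by rewrite /s add0r mulNr.
  have := Hdz t; rewrite s' xB planarN [1 - (1 - _)]subKr.
  rewrite [planar_norm _ (Y (s t))]planarC => H.
  suff -> : az t = l * - k * - k * - (Y (1 - s t) / 4 *
      ((planar_norm (X (s t)) (Y (1 - s t)) ^+ 3)^-1 +
       (planar_norm (Y (s t)) (Y (1 - s t)) ^+ 3)^-1)) by exact: H.
  by rewrite /az zs /x /y !scale3 -/(s t); ring.
have pos (a b : R) : 0 < planar_norm a b -> 0 < planar_norm (l * a) (l * b).
  by move=> ab; rewrite planar_normZ ?(ltW l0) // mulr_gt0.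
have qxy t : 0 < planar_norm (x t) (y t) by exact: pos.
have qyz t : 0 < planar_norm (y t) (z t) by rewrite zs; exact: pos.
have qxz t : 0 < planar_norm (x t) (z t) by rewrite zs; exact: pos.
have xE t : x t = l * X (k * t) by rewrite /x add0r.
have yE t : y t = l * Y (k * t) by rewrite /y add0r.
have zE' t : z t = l * Y (1 - k * t) by rewrite zE add0r.
have kT4 : k * (T / 4) = 1 by rewrite mulrA kT divff // pnatr_eq0.
exists u; split.
- split; last first.
    rewrite /u !mxE !body_signE !coordE !mul1r !xE mulr0 kT4.
    have X01 : X 0 = - X 1 by rewrite -xB subrr.
    have e21 : 2 - 1 = 1 :> R by ring.
    have Y1 : Y 1 = 0 by have := yB 1; rewrite e21; lra.
    have X1n : X 1 != 0.
      apply/eqP => X1e; have := pxy 1.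
      by rewrite X1e Y1 /planar_norm expr0n addr0 sqrtr0 ltxx.
    rewrite X01 !mulrN mulNr oppr_lt0 -expr2 exprn_even_gt0 //=.
    by rewrite mulf_neq0 // gt_eqF.
  split.
    split=> [t|i j].
      apply/rowP => j; rewrite sum_ord4 !mxE.
      by have [] := ord3P j => ->; rewrite !body_signE; ring.
    exact: (H1_period_body Hx Hy Hz i j T_gt0 Hax Hay Haz px py pz).
  move=> t.
  have xN' : x (- t) = x t by rewrite !xE mulrN xN.
  have yN' : y (- t) = y t by rewrite !yE mulrN yN.
  have zN' : z (- t) = - z t.
    rewrite !zE' mulrN opprK; have -> : 1 + k * t = 2 - (1 - k * t) by ring.
    by rewrite yB mulrN.
  have xB' : x (T / 4 + t) = x (T / 4 - t).
    by rewrite !xE !mulrDr kT4 mulrN xB addrC X1.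
  have yB' : y (T / 4 + t) = - y (T / 4 - t).
    rewrite !yE !mulrDr kT4.
    transitivity (l * - Y (1 + k * - t)); last by ring.
    by rewrite -yB; congr (_ * Y _); ring.
  have zB' : z (T / 4 + t) = z (T / 4 - t).
    rewrite !zE' !mulrDr kT4 -[in RHS]yN; congr (_ * Y _); ring.
  split; apply/rowP => j; rewrite !mxE; have [] := ord3P j => ->;
    rewrite !body_signE !coordE /= ?xN' ?yN' ?zN' ?xB' ?yB' ?zB'; ring.
- move=> i t; have du := derive1_body Hx Hy Hz i.
  split.
  + by move=> j ij; apply: body_neq.
  + exact: derivable_body Hx Hy Hz _ _.
  + by rewrite du; exact: derivable_body Hax Hay Haz _ _.
  + rewrite /derive1n /= du (derive1_body Hax Hay Haz).
    by rewrite /u body_force.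
- by move=> i t; rewrite /u px py pz.
Qed.
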